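(* Let $m,n\ge2$, $\mathbb{K}$ an infinite field, $q\in\mathbb{K}^\times$ not a root of unity. Let $K$ be an $\mathcal{H}$-prime of $\mathcal{O}_q(M_{m,n})$ and let $v\in S_{m+n}$ be its associated restricted permutation. Write $[\![a,b]\!]=\{i\in\mathbb{Z}:a\le i\le b\}$ and let $\omega\in S_{m+n}$ be the permutation with $\omega(i)=m+1-i$ for $1\le i\le m$ and $\omega(i)=2m+n+1-i$ for $m+1\le i\le m+n$. Then the Grassmann necklace $\mathcal{I}_K=(I_1,\dots,I_{m+n})$ associated to $K$ is given by $$I_{m+n-k+1}=\begin{cases}\big([\![1,m]\!]\cup[\![m+n-k+1,m+n]\!]\big)\setminus\omega v[\![1,k]\!], & k\in[\![1,n]\!],\\[4pt] \big([\![1,m+n]\!]\setminus\omega v[\![1,k]\!]\big)\cup[\![m+n-k+1,m]\!], & k\in[\![n+1,m+n]\!].\end{cases}$$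
   Context: Quantum matrices: $\mathcal{O}_q(M_{m,n})$ is the $\mathbb{K}$-algebra generated by $X_{ij}$ ($1\le i\le m$, $1\le j\le n$) subject to, for all $i<k$, $j<l$: $X_{ij}X_{il}=qX_{il}X_{ij}$, $X_{ij}X_{kj}=qX_{kj}X_{ij}$, $X_{il}X_{kj}=X_{kj}X_{il}$, $X_{ij}X_{kl}-X_{kl}X_{ij}=(q-q^{-1})X_{il}X_{kj}$. For $S=\{s_1<\dots<s_r\}\subseteq\{1,\dots,m\}$, $T=\{t_1<\dots<t_r\}\subseteq\{1,\dots,n\}$, $[S|T]_q=\sum_{\sigma\in S_r}(-q)^{l(\sigma)}X_{s_1,t_{\sigma(1)}}\cdots X_{s_r,t_{\sigma(r)}}$; the empty minor is $1$. The torus $\mathcal{H}=(\mathbb{K}^\times)^{m+n}$ acts by $(\alpha,\beta)\cdot X_{ij}=\alpha_i\beta_jX_{ij}$; an $\mathcal{H}$-prime is an $\mathcal{H}$-invariant prime ideal. Cauchon diagrams: an $m\times n$ Cauchon diagram is an $m\times n$ grid of squares, each coloured black or white, such that no black square has both a white square to its left in the same row and a white square above it in the same column; rows are numbered $1,\dots,m$ from top to bottom and columns $1,\dots,n$ from left to right. The $\mathcal{H}$-primes of $\mathcal{O}_q(M_{m,n})$ are in bijection with $m\times n$ Cauchon diagrams (Cauchon); the bijection is characterised as follows. For a diagram $C$, form the directed graph whose vertices are the white squares, together with a source for each row (at its right end) and a sink for each column (at its bottom end), with edges from each row source to the rightmost white square of its row, from each white square to the next white square to its left in its row, from each white square to the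 next white square below it in its column, and from the lowest white square of each column to that column's sink. Then $[S|T]_q$ lies in the $\mathcal{H}$-prime of $C$ iff there is no family of $|S|$ pairwise vertex-disjoint directed paths joining the sources of the rows $S$ to the sinks of the columns $T$. Restricted permutation: let $s_i=(i\ i+1)\in S_{m+n}$. The square in the $a$-th row from the bottom and $c$-th column from the left carries $s_{a+c-1}$. The restricted permutation $v$ of $K$ is the product of the $s_i$ in the black squares of its Cauchon diagram, written down left to right along each row, rows taken from top to bottom; permutations are composed from right to left. Grassmann necklace of $K$: let $d=m+n$; an $m$-subset $I\subseteq\{1,\dots,d\}$ corresponds to the minor index $S_I=\{1,\dots,m\}\setminus I$, $T_I=\{m+n+1-j:j\in I,\ j>m\}$. Let $\le_i$ be the total order $i<_ii+1<_i\dots<_id<_i1<_i\dots<_ii-1$, extended to $m$-subsets by: $\{s_1<_i\dots<_is_m\}\le_i\{t_1<_i\dots<_it_m\}$ iff $s_r\le_it_r$ for all $r$. The Grassmann necklace of $K$ is $(I_1,\dots,I_d)$, with $I_i$ the $\le_i$-minimum of the set of $m$-subsets $I$ with $[S_I|T_I]_q\notin K$ (it exists; equivalently, it is the Grassmann necklace of the totally nonnegative cell with the same Cauchon diagram as $K$, i.e. the cell of totally nonnegative real $m\times n$ matrices whose vanishing minors $[S|T]$ are exactly those with $[S|T]_q\in K$). *)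

(* Defs.v *)
From HB Require Import structures.
From mathcomp Require Import all_boot all_order all_fingroup all_algebra.
From mathcomp Require Import generic_quotient.
From mathcomp Require Import boolp.
From mathcomp Require classical_sets cardinality.

Set Implicit Arguments.
Unset Strict Implicit.
Unset Printing Implicit Defensive.

Import GRing.Theory.
Local Open Scope ring_scope.
Local Open Scope quotient_scope.

Section QuantumMatrices.
Variables (F : fieldType) (m n : nat) (q : F).

Inductive qterm : Type :=
| QVar of 'I_m & 'I_n
| QScal of F
| QAdd of qterm & qterm
| QOpp of qterm
| QMul of qterm & qterm.

Declare Scope qterm_scope.
Delimit Scope qterm_scope with T.
Local Notation "x + y" := (QAdd x%T y%T) : qterm_scope.
Local Notation "- x" := (QOpp x%T) : qterm_scope.
Local Notation "x - y" := (QAdd x%T (QOpp y%T)) : qterm_scope.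
Local Notation "x * y" := (QMul x%T y%T) : qterm_scope.
Local Notation "c %:C" := (QScal c%R)
  (at level 2, left associativity, format "c %:C") : qterm_scope.
Local Notation "''x_' ( i , j )" := (QVar i j)
  (at level 8, format "''x_' ( i ,  j )") : qterm_scope.
Reserved Notation "x ~~ y" (at level 70).

(* The least congruence on expressions containing the axioms of unital
   associative F-algebras and the defining relations of O_q(M_{m,n}). *)
Inductive qeq : qterm -> qterm -> Prop :=
| qeq_refl x : x ~~ x
| qeq_sym x y : x ~~ y -> y ~~ x
| qeq_trans x y z : x ~~ y -> y ~~ z -> x ~~ z
| qeq_add x x' y y' : x ~~ x' -> y ~~ y' -> x + y ~~ x' + y'
| qeq_opp x x' : x ~~ x' -> - x ~~ - x'
| qeq_mul x x' y y' : x ~~ x' -> y ~~ y' -> x * y ~~ x' * y'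
| qeq_addA x y z : x + (y + z) ~~ (x + y) + z
| qeq_addC x y : x + y ~~ y + x
| qeq_add0 x : 0%:C + x ~~ x
| qeq_addN x : - x + x ~~ 0%:C
| qeq_mulA x y z : x * (y * z) ~~ (x * y) * z
| qeq_mul1l x : 1%:C * x ~~ x
| qeq_mul1r x : x * 1%:C ~~ x
| qeq_mulDl x y z : (x + y) * z ~~ x * z + y * z
| qeq_mulDr x y z : x * (y + z) ~~ x * y + x * z
| qeq_scalD a b : (a + b)%:C ~~ a%:C + b%:C
| qeq_scalM a b : (a * b)%:C ~~ a%:C * b%:C
| qeq_scalC a x : a%:C * x ~~ x * a%:C
| qeq_row i (j l : 'I_n) : (j < l)%N ->
    'x_(i, j) * 'x_(i, l) ~~ q%:C * ('x_(i, l) * 'x_(i, j))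
| qeq_col (i k : 'I_m) j : (i < k)%N ->
    'x_(i, j) * 'x_(k, j) ~~ q%:C * ('x_(k, j) * 'x_(i, j))
| qeq_anti (i k : 'I_m) (j l : 'I_n) : (i < k)%N -> (j < l)%N ->
    'x_(i, l) * 'x_(k, j) ~~ 'x_(k, j) * 'x_(i, l)
| qeq_diag (i k : 'I_m) (j l : 'I_n) : (i < k)%N -> (j < l)%N ->
    'x_(i, j) * 'x_(k, l) - 'x_(k, l) * 'x_(i, j)
      ~~ (q - q^-1)%:C * ('x_(i, l) * 'x_(k, j))
where "x ~~ y" := (qeq x%T y%T).

(* The congruence is turned into a boolean relation classically. *)
HB.instance Definition _ := gen_eqMixin qterm.
HB.instance Definition _ := gen_choiceMixin qterm.

Definition qeqb (x y : qterm) : bool := `[< qeq x y >].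

Lemma qeqb_equiv : equiv_class_of qeqb.
Proof.
split=> [x|x y|y x z].
- exact/asboolP/qeq_refl.
- by apply/asboolP/asboolP; apply: qeq_sym.
- by move=> /asboolP xy /asboolP yz; apply/asboolP/(qeq_trans xy).
Qed.

Canonical qeqb_equivRel := EquivRelPack qeqb_equiv.

Definition qmat : Type := {eq_quot qeqb}.
HB.instance Definition _ := Choice.on qmat.

Definition qcls (t : qterm) : qmat := \pi_({eq_quot qeqb}) t.

Lemma qclsP (t u : qterm) : qcls t = qcls u <-> qeq t u.
Proof.
split=> [/eqquotP/asboolP //|tu].
exact/eqquotP/asboolP.
Qed.

Definition qrep (a : qmat) : qterm := repr (a : {eq_quot qeqb}).

Lemma qrepK a : qcls (qrep a) = a.
Proof. exact: reprK. Qed.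

Lemma qrep_cls t : qeq (qrep (qcls t)) t.
Proof. by apply/qclsP; rewrite qrepK. Qed.

Definition qadd (a b : qmat) := qcls (QAdd (qrep a) (qrep b)).
Definition qopp (a : qmat) := qcls (QOpp (qrep a)).
Definition qmul (a b : qmat) := qcls (QMul (qrep a) (qrep b)).

Lemma qcls_add t u : qcls (QAdd t u) = qadd (qcls t) (qcls u).
Proof. by apply/esym/qclsP/qeq_add; apply: qrep_cls. Qed.
Lemma qcls_opp t : qcls (QOpp t) = qopp (qcls t).
Proof. exact/esym/qclsP/qeq_opp/qrep_cls. Qed.
Lemma qcls_mul t u : qcls (QMul t u) = qmul (qcls t) (qcls u).
Proof. by apply/esym/qclsP/qeq_mul; apply: qrep_cls. Qed.

Let qmatE := (qcls_add, qcls_opp, qcls_mul).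

Lemma qcls_ind (P : qmat -> Prop) : (forall t, P (qcls t)) -> forall a, P a.
Proof. by move=> Pt a; rewrite -(qrepK a). Qed.

Fact qaddA : associative qadd.
Proof.
elim/qcls_ind=> x; elim/qcls_ind=> y; elim/qcls_ind=> z.
rewrite -!qmatE; exact/qclsP/qeq_addA.
Qed.
Fact qaddC : commutative qadd.
Proof.
elim/qcls_ind=> x; elim/qcls_ind=> y.
rewrite -!qmatE; exact/qclsP/qeq_addC.
Qed.
Fact qadd0 : left_id (qcls (QScal 0)) qadd.
Proof. by elim/qcls_ind=> x; rewrite -!qmatE; exact/qclsP/qeq_add0. Qed.
Fact qaddN : left_inverse (qcls (QScal 0)) qopp qadd.
Proof. by elim/qcls_ind=> x; rewrite -!qmatE; exact/qclsP/qeq_addN. Qed.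

HB.instance Definition _ :=
  GRing.isZmodule.Build qmat qaddA qaddC qadd0 qaddN.

Section Eval.
Variables (B : algType F) (x : 'I_m -> 'I_n -> B).

Definition qrelations : Prop :=
  [/\ forall i (j l : 'I_n), (j < l)%N -> x i j * x i l = q *: (x i l * x i j),
      forall (i k : 'I_m) j, (i < k)%N -> x i j * x k j = q *: (x k j * x i j),
      forall (i k : 'I_m) (j l : 'I_n), (i < k)%N -> (j < l)%N ->
        x i l * x k j = x k j * x i l
    & forall (i k : 'I_m) (j l : 'I_n), (i < k)%N -> (j < l)%N ->
        x i j * x k l - x k l * x i j = (q - q^-1) *: (x i l * x k j)].

Fixpoint qeval (t : qterm) : B :=
  match t with
  | QVar i j => x i j
  | QScal c => c%:A
  | QAdd t u => qeval t + qeval u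
  | QOpp t => - qeval t
  | QMul t u => qeval t * qeval u
  end.

Lemma qeval_eq t u : qrelations -> qeq t u -> qeval t = qeval u.
Proof.
case=> rrow rcol ranti rdiag; elim=> //=.
- by move=> ? ? ? _ -> _ ->.
- by move=> ? ? ? ? _ -> _ ->.
- by move=> ? ? _ ->.
- by move=> ? ? ? ? _ -> _ ->.
- by move=> *; rewrite addrA.
- by move=> *; rewrite addrC.
- by move=> *; rewrite scale0r add0r.
- by move=> *; rewrite scale0r addNr.
- by move=> *; rewrite mulrA.
- by move=> *; rewrite scale1r mul1r.
- by move=> *; rewrite scale1r mulr1.
- by move=> *; rewrite mulrDl.
- by move=> *; rewrite mulrDr.
- by move=> *; rewrite scalerDl.
- by move=> *; rewrite mulr_algl scalerA.
- by move=> *; rewrite mulr_algl mulr_algr.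
- by move=> *; rewrite mulr_algl rrow.
- by move=> *; rewrite mulr_algl rcol.
- by move=> *; rewrite mulr_algl rdiag.
Qed.

End Eval.

Fact qmulA : associative qmul.
Proof.
elim/qcls_ind=> x; elim/qcls_ind=> y; elim/qcls_ind=> z.
rewrite -!qmatE; exact/qclsP/qeq_mulA.
Qed.
Fact qmul1l : left_id (qcls (QScal 1)) qmul.
Proof. by elim/qcls_ind=> x; rewrite -!qmatE; exact/qclsP/qeq_mul1l. Qed.
Fact qmul1r : right_id (qcls (QScal 1)) qmul.
Proof. by elim/qcls_ind=> x; rewrite -!qmatE; exact/qclsP/qeq_mul1r. Qed.
Fact qmulDl : left_distributive qmul +%R.
Proof.
elim/qcls_ind=> x; elim/qcls_ind=> y; elim/qcls_ind=> z.
rewrite /GRing.add /= -!qmatE; exact/qclsP/qeq_mulDl.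
Qed.
Fact qmulDr : right_distributive qmul +%R.
Proof.
elim/qcls_ind=> x; elim/qcls_ind=> y; elim/qcls_ind=> z.
rewrite /GRing.add /= -!qmatE; exact/qclsP/qeq_mulDr.
Qed.
Fact qone_neq0 : qcls (QScal 1) != 0.
Proof.
apply/eqP=> /qclsP H.
have r0 : qrelations (fun _ _ => 0 : F^o).
  by split=> *; rewrite !mul0r ?subrr ?scaler0.
have := qeval_eq r0 H.
by rewrite /= scale1r scale0r; move/eqP; rewrite oner_eq0.
Qed.

HB.instance Definition _ := GRing.Zmodule_isNzRing.Build qmat
  qmulA qmul1l qmul1r qmulDl qmulDr qone_neq0.

Definition qscale (c : F) (a : qmat) : qmat := qmul (qcls (QScal c)) a.

Fact qscaleA a b v : qscale a (qscale b v) = qscale (a * b) v.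
Proof.
rewrite /qscale qmulA; congr qmul; rewrite -qmatE.
exact/qclsP/qeq_sym/qeq_scalM.
Qed.
Fact qscale1 : left_id 1 qscale.
Proof. exact: qmul1l. Qed.
Fact qscaleDr : right_distributive qscale +%R.
Proof. by move=> a u v; apply: qmulDr. Qed.
Fact qscaleDl v : {morph qscale^~ v : a b / a + b}.
Proof.
move=> a b; rewrite /qscale -qmulDl; congr qmul.
rewrite /GRing.add /= -qmatE; exact/qclsP/qeq_scalD.
Qed.

HB.instance Definition _ := GRing.Zmodule_isLmodule.Build F qmat
  qscaleA qscale1 qscaleDr qscaleDl.

Fact qscaleAl (a : F) (u v : qmat) : a *: (u * v) = (a *: u) * v.
Proof. exact: qmulA. Qed.

HB.instance Definition _ := GRing.Lmodule_isLalgebra.Build F qmat qscaleAl.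

Fact qscaleAr (a : F) (u v : qmat) : a *: (u * v) = u * (a *: v).
Proof.
suff aC : qcls (QScal a) * u = u * qcls (QScal a).
  rewrite -[LHS]/(qcls (QScal a) * (u * v)).
  by rewrite -[a *: v]/(qcls (QScal a) * v) !mulrA aC.
elim/qcls_ind: u => u; rewrite /GRing.mul /= -!qmatE.
exact/qclsP/qeq_scalC.
Qed.

HB.instance Definition _ := GRing.Lalgebra_isAlgebra.Build F qmat qscaleAr.

Definition qgen (i : 'I_m) (j : 'I_n) : qmat := qcls (QVar i j).

Lemma qcls_scal c : qcls (QScal c) = c%:A.
Proof. by rewrite -[RHS]/(qcls (QScal c) * 1) mulr1. Qed.

Lemma qclsD t u : qcls (QAdd t u) = qcls t + qcls u.
Proof. exact: qcls_add. Qed.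
Lemma qclsN t : qcls (QOpp t) = - qcls t.
Proof. exact: qcls_opp. Qed.
Lemma qclsM t u : qcls (QMul t u) = qcls t * qcls u.
Proof. exact: qcls_mul. Qed.

Lemma qgen_relations : qrelations qgen.
Proof.
split=> [i j l jl|i k j ik|i k j l ik jl|i k j l ik jl].
- by have /qclsP := qeq_row i jl; rewrite !qclsM qcls_scal mulr_algl.
- by have /qclsP := qeq_col j ik; rewrite !qclsM qcls_scal mulr_algl.
- by have /qclsP := qeq_anti ik jl; rewrite !qclsM.
- have /qclsP := qeq_diag ik jl.
  by rewrite qclsD qclsN !qclsM qcls_scal mulr_algl.
Qed.

Section Lift.
Variables (B : algType F) (x : 'I_m -> 'I_n -> B).

(* The K-algebra morphism qmat -> B sending each generator X_ij to x i j; it is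
   meaningful when x satisfies the relations. *)
Definition qlift (a : qmat) : B := qeval x (qrep a).

Hypothesis rx : qrelations x.

Lemma qlift_cls t : qlift (qcls t) = qeval x t.
Proof. exact/qeval_eq/qrep_cls. Qed.
Lemma qlift_gen i j : qlift (qgen i j) = x i j.
Proof. exact: qlift_cls. Qed.
Lemma qliftD a b : qlift (a + b) = qlift a + qlift b.
Proof.
elim/qcls_ind: a => t; elim/qcls_ind: b => u.
by rewrite -qclsD !qlift_cls.
Qed.
Lemma qliftM a b : qlift (a * b) = qlift a * qlift b.
Proof.
elim/qcls_ind: a => t; elim/qcls_ind: b => u.
by rewrite -qclsM !qlift_cls.
Qed.
Lemma qliftZ c a : qlift (c *: a) = c *: qlift a.
Proof.
by rewrite -[c *: a]/(qcls (QScal c) * a) qliftM qlift_cls /= mulr_algl.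
Qed.
Lemma qlift1 : qlift 1 = 1.
Proof. by rewrite qlift_cls /= scale1r. Qed.

End Lift.

Definition torus_act (alpha : 'I_m -> F) (beta : 'I_n -> F) : qmat -> qmat :=
  qlift (fun i j => (alpha i * beta j) *: qgen i j).

Lemma torus_relations (alpha : 'I_m -> F) (beta : 'I_n -> F) :
  qrelations (fun i j => (alpha i * beta j) *: qgen i j).
Proof.
have [rrow rcol ranti rdiag] := qgen_relations.
have scM a b u v : (a *: u) * (b *: v) = (a * b) *: (u * v) :> qmat.
  by rewrite -scalerAl -scalerAr scalerA.
have swap a b c d : a * b * (c * d) = a * d * (c * b) :> F.
  by rewrite (mulrC c) mulrACA (mulrC b).
split=> *; rewrite !scM.
- rewrite rrow // !scalerA; congr (_ *: _).
  by rewrite [LHS]mulrC; congr (_ * _); rewrite [LHS]mulrC.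
- rewrite rcol // !scalerA; congr (_ *: _).
  by rewrite [LHS]mulrC; congr (_ * _); rewrite [LHS]mulrC.
- by rewrite ranti //; congr (_ *: _); rewrite [LHS]mulrC.
- rewrite [X in _ - X *: _]mulrC -scalerBr rdiag // !scalerA; congr (_ *: _).
  by rewrite [LHS]mulrC; congr (_ * _); rewrite swap.
Qed.

Lemma torus_act_gen alpha beta i j :
  torus_act alpha beta (qgen i j) = (alpha i * beta j) *: qgen i j.
Proof. exact/qlift_gen/torus_relations. Qed.

End QuantumMatrices.

Section Ideals.
Variable R : nzRingType.

Definition two_sided_ideal (I : R -> Prop) : Prop :=
  [/\ I 0, forall a b, I a -> I b -> I (a + b)
    & forall r a, I a -> I (r * a) /\ I (a * r)].

Definition prime_ideal (P : R -> Prop) : Prop :=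
  [/\ two_sided_ideal P, ~ P 1
    & forall I J : R -> Prop, two_sided_ideal I -> two_sided_ideal J ->
      (forall a b, I a -> J b -> P (a * b)) ->
      (forall a, I a -> P a) \/ (forall b, J b -> P b)].

End Ideals.

Section HPrimes.
Variables (F : fieldType) (m n : nat) (q : F).

Definition torus_invariant (P : qmat m n q -> Prop) : Prop :=
  forall (alpha : 'I_m -> F) (beta : 'I_n -> F),
    (forall i, alpha i != 0) -> (forall j, beta j != 0) ->
    forall a, P a -> P (torus_act alpha beta a).

Definition Hprime (P : qmat m n q -> Prop) : Prop :=
  prime_ideal P /\ torus_invariant P.

End HPrimes.

Definition perm_length (r : nat) (s : 'S_r) : nat :=
  #|[set p : 'I_r * 'I_r | (p.1 < p.2)%N && (s p.2 < s p.1)%N]|.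

(* [enum] lists a set of ordinals increasingly, so for #|S| = #|T| the zipped
   list is (s_1, t_{sigma 1}), ..., (s_r, t_{sigma r}).  The (noncommutative)
   product is taken in the order of this list.  Only meaningful for
   #|S| = #|T|. *)
Definition qminor (F : fieldType) (m n : nat) (q : F)
    (S : {set 'I_m}) (T : {set 'I_n}) : qmat m n q :=
  \sum_(sigma : 'S_#|T|) (- q) ^+ perm_length sigma *:
    \prod_(p <- zip (enum S)
                    [seq enum_val (A := mem T) (sigma k) | k <- enum 'I_#|T|])
       qgen q p.1 p.2.

Section Cauchon.
Variables m n : nat.

(* A diagram is given by its set C of black squares; rows are numbered from the
   top and columns from the left. *)
Implicit Type C : {set 'I_m * 'I_n}.

Definition cauchon C : Prop :=
  forall i j, (i, j) \in C ->
    ~ ((exists2 j' : 'I_n, (j' < j)%N & (i, j') \notin C) /\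
       (exists2 i' : 'I_m, (i' < i)%N & (i', j) \notin C)).

Definition vertex : finType := ('I_m + 'I_n + 'I_m * 'I_n)%type.
Definition Source (i : 'I_m) : vertex := inl (inl i).
Definition Sink (j : 'I_n) : vertex := inl (inr j).
Definition Square (i : 'I_m) (j : 'I_n) : vertex := inr (i, j).

Definition edge C : rel vertex := fun x y =>
  match x, y with
  | inl (inl i), inr (i', j) =>
      [&& i == i', (i, j) \notin C
        & [forall l : 'I_n, (j < l)%N ==> ((i, l) \in C)]]
  | inr (i, j), inr (i', j') =>
      [&& (i, j) \notin C, (i', j') \notin C
        & [&& i == i', (j' < j)%N
             & [forall l : 'I_n, (j' < l < j)%N ==> ((i, l) \in C)]]
          || [&& j == j', (i < i')%N
             & [forall k : 'I_m, (i < k < i')%N ==> ((k, j) \in C)]]]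
  | inr (i, j), inl (inr j') =>
      [&& j == j', (i, j) \notin C
        & [forall k : 'I_m, (i < k)%N ==> ((k, j) \in C)]]
  | _, _ => false
  end.

(* Vertex-disjointness makes the end points distinct, so for #|S| = #|T| the
   sinks reached are exactly those of T. *)
Definition disjoint_path_family C (S : {set 'I_m}) (T : {set 'I_n}) : Prop :=
  exists p : 'I_m -> seq vertex,
    (forall i, i \in S -> path (edge C) (Source i) (p i) /\
       exists2 j, j \in T & last (Source i) (p i) = Sink j) /\
    (forall i i', i \in S -> i' \in S -> i != i' ->
       [disjoint Source i :: p i & Source i' :: p i']).

(* Cauchon's bijection, through its characterisation by quantum minors: C is the
   diagram of the H-prime P. *)
Definition cauchon_diagram_of (F : fieldType) (q : F)
    (P : qmat m n q -> Prop) C : Prop :=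
  cauchon C /\
  forall (S : {set 'I_m}) (T : {set 'I_n}), #|S| = #|T| ->
    (P (qminor q S T) <-> ~ disjoint_path_family C S T).

End Cauchon.

(* From here on, x : 'I_d stands for the label x.+1 of {1, ..., d}. *)

(* The transposition (k  k+1) of labels, for 0 < k < d. *)
Definition simple_transp (d k : nat) : 'S_d :=
  match insub k.-1, insub k with
  | Some x, Some y => tperm x y
  | _, _ => 1%g
  end.

(* Row i from the top is row m - i from the bottom (i being 0-based).  The
   product of permutations in MathComp is composed from left to right, whence
   the order of the factors in foldr: the word s_1 s_2 ... s_r denotes the map
   x |-> s_1 (s_2 (... (s_r x))). *)
Definition restricted_perm (m n : nat) (C : {set 'I_m * 'I_n}) : 'S_(m + n) :=
  foldr (fun (b : 'I_m * 'I_n) (w : 'S_(m + n)) =>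
           (w * simple_transp (m + n) ((m - b.1) + b.2.+1 - 1))%g)
        1%g
        [seq b <- [seq (i, j) | i <- enum 'I_m, j <- enum 'I_n] | b \in C].

Definition label_itv (d a b : nat) : {set 'I_d} :=
  [set x : 'I_d | (a <= x.+1 <= b)%N].

(* For 1 <= i <= d, the label x.+1 is in position (x.+1 - i) mod d for the
   order i <_i i+1 <_i ... <_i d <_i 1 <_i ... <_i i-1. *)
Definition cyc_le (d i : nat) : rel 'I_d := fun x y =>
  ((x.+1 + d - i) %% d <= (y.+1 + d - i) %% d)%N.

Definition subset_le (d i : nat) (I J : {set 'I_d}) : bool :=
  all2 (@cyc_le d i) (sort (@cyc_le d i) (enum I)) (sort (@cyc_le d i) (enum J)).

Section Necklace.
Variables m n : nat.

Definition minor_rows (I : {set 'I_(m + n)}) : {set 'I_m} :=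
  [set s : 'I_m | lshift n s \notin I].

Definition minor_cols (I : {set 'I_(m + n)}) : {set 'I_n} :=
  [set t : 'I_n |
    [exists x in I, (m < x.+1)%N && (t.+1 == m + n + 1 - x.+1)%N]].

Variables (F : fieldType) (q : F) (P : qmat m n q -> Prop).

Definition nonvanishing (I : {set 'I_(m + n)}) : Prop :=
  #|I| = m /\ ~ P (qminor q (minor_rows I) (minor_cols I)).

Definition is_minimum (i : nat) (I : {set 'I_(m + n)}) : Prop :=
  nonvanishing I /\ forall J, nonvanishing J -> subset_le i I J.

(* I_i for 1 <= i <= m + n; set0, which is not an m-subset when m > 0, would be
   returned if there were no minimum. *)
Definition grassmann_necklace (i : nat) : {set 'I_(m + n)} :=
  odflt set0 [pick I : {set 'I_(m + n)} | `[< is_minimum i I >]].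

End Necklace.

(* Main.v *)
(* Label the source of row i by i and the sink of column j by m + n + 1 - j.  A
   subset I of m labels is nonvanishing iff vertex-disjoint paths of the Cauchon
   graph lead from the set of all sources onto the vertices labelled by I (the
   sources in I use the trivial path): the nonvanishing sets are the bases of a
   gammoid.  Give each source a basis vector of Q^m and each other vertex a
   generic combination of the vectors of its predecessors; then I is
   nonvanishing iff the vectors w_x, x in I, form a basis, and I_i is the greedy
   basis {x | w_x is not in the span of the w_y, y <_i x}.

   These spans are computed by whitening the squares of an all-black diagram one
   by one, rows from top to bottom and each row from right to left.  Whitening a
   square replaces the vector of its column by a combination of it and the vector
   of a label which precedes it up to zero vectors (this uses the
   Cauchon condition).  For each label x, the longest cyclic interval ending
   before x whose span misses w_x is governed by a permutation, which changes by
   a transposition; and omega v w_0, with w_0 the reversal of the labels, traces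
   the pipes of the diagram (crossing at black squares) and changes by the same
   transposition. *)
Require Import Defs.
From mathcomp Require Import all_boot all_order all_fingroup all_algebra.
From mathcomp Require classical_sets cardinality.
From mathcomp Require Import boolp zify.

Set Implicit Arguments.
Unset Strict Implicit.
Unset Printing Implicit Defensive.

(** * The pipes of a diagram *)

Section PipeDream.
Variables m n : nat.
Implicit Types (b : nat * nat) (l : seq (nat * nat)) (c : nat -> nat -> bool).

Definition swap_nat k x := if x == k.-1 then k else if x == k then k.-1 else x.

(** Counted from 0, square [(i, j)] lies in row [m - i] from the bottom and column [j + 1], whence
    the index [(m - i) + (j + 1) - 1]. *)
Definition box_index b := m - b.1 + b.2.

Definition act_nat l x := foldr (fun b y => swap_nat (box_index b) y) x l.

Lemma act_nat_cat l1 l2 x : act_nat (l1 ++ l2) x = act_nat l1 (act_nat l2 x).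
Proof. exact: foldr_cat. Qed.

Lemma act_nat_fix l x :
  {in l, forall b, (x < (box_index b).-1) || (box_index b < x)} -> act_nat l x = x.
Proof.
elim: l => //= b l IH bx; rewrite IH; last first.
  by move=> b' b'l; apply: bx; rewrite inE b'l orbT.
have := bx b (mem_head _ _); rewrite /swap_nat; do 2?case: eqP; lia.
Qed.

Definition row_word (i s k : nat) : seq (nat * nat) := [seq (i, j) | j <- iota s k].

Lemma row_wordP i s k b : reflect (b.1 = i /\ s <= b.2 < s + k) (b \in row_word i s k).
Proof.
apply: (iffP mapP) => [[j + ->]|[]]; rewrite ?mem_iota //=.
by case: b => b1 b2 /= -> sb; exists b2; rewrite ?mem_iota.
Qed.

Definition rows_word i k : seq (nat * nat) := [seq (i', j) | i' <- iota i k, j <- iota 0 n].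

Lemma rows_wordP i k b :
  reflect (i <= b.1 < i + k /\ b.2 < n) (b \in rows_word i k).
Proof.
apply: (iffP allpairsP) => [[[x y] /= [+ + ->]]|[b1 b2]]; rewrite ?mem_iota //=.
by exists b; rewrite !mem_iota -surjective_pairing.
Qed.

(** The letters of a row have consecutive indices and the last one acts first, so each lowers the
    point by one: a pipe runs west along black squares. *)
Lemma row_word_left i j : i < m -> act_nat (row_word i 0 j) (m - i + j).-1 = (m - i).-1.
Proof.
move=> im; elim: j => [|j IH]; first by rewrite addn0.
rewrite /row_word -addn1 iotaD map_cat act_nat_cat add0n /= /swap_nat /box_index /=.
by case: eqP => [|_]; [lia|rewrite addnA addn1 eqxx IH].
Qed.

Lemma row_word_split i j : j < n ->
  row_word i 0 n = row_word i 0 j ++ (i, j) :: row_word i j.+1 (n - j.+1).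
Proof.
move=> jn; rewrite -[_ :: _]/(row_word i j (n - j.+1).+1) /row_word -map_cat -iotaD.
by congr [seq _ | _ <- iota _ _]; lia.
Qed.

(** Only the letter of column [j] moves the point: earlier acting letters have indices too large,
    later ones too small for the raised point. A pipe crosses a black row northwards. *)
Lemma row_word_up i j : i < m -> j < n ->
  act_nat (row_word i 0 n) (m - i + j).-1 = m - i + j.
Proof.
move=> im jn; rewrite (row_word_split i jn) act_nat_cat /=.
rewrite [act_nat (row_word i j.+1 _) _]act_nat_fix; last first.
  by move=> b /row_wordP [b1 b2]; rewrite /box_index b1; lia.
rewrite /swap_nat /box_index /= eqxx act_nat_fix //.
by move=> b /row_wordP [b1 b2]; rewrite /box_index b1; lia.
Qed.

Lemma rows_word_cons i k : rows_word i k.+1 = row_word i 0 n ++ rows_word i.+1 k.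
Proof. by []. Qed.

Lemma rows_word_up i k j : i + k = m -> j < n -> act_nat (rows_word i k) j = k + j.
Proof.
elim: k i => [|k IH] i ik jn //.
rewrite rows_word_cons act_nat_cat IH //; last by lia.
rewrite (_ : k + j = (m - i + j).-1); last by lia.
by rewrite row_word_up //; lia.
Qed.

(** A pipe entering at the east end of a row escapes the rows below, whose indices are too small,
    runs west along its own row, and ends below all indices of the rows above. *)
Lemma rows_word_left i k r : i + k = m -> r < k -> act_nat (rows_word i k) (n + r) = r.
Proof.
elim: k i => [|k IH] i ik // rk; rewrite rows_word_cons act_nat_cat.
have [ltrk|lekr] := ltnP r k.
  rewrite IH //; last by lia.
  rewrite act_nat_fix // => b /row_wordP [b1 b2]; rewrite /box_index b1; lia.
rewrite [act_nat (rows_word _ _) _]act_nat_fix; last first.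
  by move=> b /rows_wordP [b1 b2]; rewrite /box_index; lia.
rewrite (_ : n + r = (m - i + n).-1); last by lia.
by rewrite row_word_left //; lia.
Qed.

(** * Words of squares as permutations of the labels *)

Definition wordp l : 'S_(m + n) :=
  foldr (fun b w => (w * simple_transp (m + n) (box_index b))%g) 1%g l.

Lemma wordp_cat l1 l2 : wordp (l1 ++ l2) = (wordp l2 * wordp l1)%g.
Proof.
elim: l1 => [|b l1 IH] /=; first by rewrite mulg1.
by rewrite IH mulgA.
Qed.

Lemma simple_transpE (d k : nat) (x y : 'I_d) : 0 < k -> x = k.-1 :> nat -> y = k :> nat ->
  simple_transp d k = tperm x y.
Proof.
move=> k0 xk yk; rewrite /simple_transp.
by rewrite (_ : insub k.-1 = Some x) 1?(_ : insub k = Some y) // -?xk -?yk valK.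
Qed.

Lemma wordpE l (x : 'I_(m + n)) :
  {in l, forall b, b.1 < m /\ b.2 < n} -> wordp l x = act_nat l x :> nat.
Proof.
elim: l => [|b l IH] lP /=; first by rewrite perm1.
have [b1 b2] := lP b (mem_head _ _).
rewrite permM -IH; last by move=> b' b'l; apply: lP; rewrite inE b'l orbT.
have k0 : 0 < box_index b by rewrite /box_index; lia.
have kd : box_index b < m + n by rewrite /box_index; lia.
have kd' : (box_index b).-1 < m + n by lia.
rewrite (@simple_transpE _ _ (Ordinal kd') (Ordinal kd)) // /swap_nat.
case: tpermP => [->|->|/eqP + /eqP] /=; rewrite ?eqxx //.
  by case: eqP => //; lia.
by rewrite -!val_eqE /= => /negPf -> /negPf ->.
Qed.

Definition word c := [seq b <- rows_word 0 m | c b.1 b.2].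

Lemma word_in c b : b \in word c -> b.1 < m /\ b.2 < n.
Proof. by rewrite mem_filter => /andP [_ /rows_wordP [/andP [_ bm] bn]]. Qed.

Lemma restricted_permE (C : {set 'I_m * 'I_n}) c :
  (forall (i : 'I_m) (j : 'I_n), c i j = ((i, j) \in C)) -> restricted_perm C = wordp (word c).
Proof.
move=> cC; rewrite /restricted_perm.
have -> : word c = [seq (nat_of_ord b.1, nat_of_ord b.2)
    | b : 'I_m * 'I_n <- [seq b <- [seq (i, j) | i <- enum 'I_m, j <- enum 'I_n] | b \in C]].
  rewrite /word /rows_word -!val_enum_ord allpairs_mapl allpairs_mapr.
  rewrite -(map_allpairs (fun b : 'I_m * 'I_n => (val b.1, val b.2)) pair).
  rewrite filter_map; congr map; apply: eq_filter => -[i j] /=.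
  by rewrite cC.
elim: [seq b <- _ | _] => //= b l ->; congr (_ * _)%g; congr simple_transp.
by rewrite /box_index /= addnS subn1.
Qed.

(* The squares still to be whitened are those below row i and those in row i to
   the left of column j. *)
Definition stage_black c i j : nat -> nat -> bool :=
  fun i' j' => [|| c i' j', i < i' | (i' == i) && (j' < j)].

Lemma eq_word c c' : (forall i j, i < m -> j < n -> c i j = c' i j) ->
  word c = word c'.
Proof.
move=> cc; apply: eq_in_filter => b /rows_wordP [/andP [_ bm] bn].
exact: cc.
Qed.

Lemma rows_word_split i : i < m ->
  rows_word 0 m = rows_word 0 i ++ row_word i 0 n ++ rows_word i.+1 (m - i.+1).
Proof.
move=> im; rewrite -rows_word_cons /rows_word -allpairs_cat; congr allpairs.
by rewrite -iotaD; congr iota; lia.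
Qed.

Variable omega : 'S_(m + n).
Hypothesis omegaE : forall x : 'I_(m + n),
  omega x = (if x < m then m - x.+1 else 2 * m + n - x.+1) :> nat.

(* From the south-west corner on, the labels of the south-east boundary edges
   decrease; pipe c x is the label of the north-west boundary edge where the pipe
   entering at x ends. *)
Definition pipe c : 'S_(m + n) := (perm (@rev_ord_inj (m + n)%N) * wordp (word c) * omega)%g.

(** When every square is black all pipes go straight, and opposite boundary edges bear the same
    label. *)
Lemma pipe_all c : (forall i j, i < m -> j < n -> c i j) -> pipe c = 1%g.
Proof.
move=> cT; apply/permP=> x; rewrite /pipe !permM permE perm1; apply: val_inj.
rewrite /= omegaE wordpE; last exact: word_in.
have -> : word c = rows_word 0 m.
  apply/all_filterP/allP => b /rows_wordP [/andP [_ bm] bn]; exact: cT.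
rewrite /=; have [xm|mx] := ltnP x m.
  rewrite (_ : m + n - x.+1 = n + (m - x.+1)); last by lia.
  by rewrite rows_word_left //; [case: ifP|]; lia.
have xd := ltn_ord x; rewrite rows_word_up //; [case: ifP|]; lia.
Qed.

(** Whitening a square deletes its letter, so the two pipes crossing there exchange their ends. All
    squares to the south and to the west are still black: one of these pipes comes straight up from
    column [j], the other runs straight west and ends at row [i]. *)
Lemma pipe_step c i j (x y : 'I_(m + n)) : i < m -> j < n -> ~~ c i j ->
    x = i :> nat -> y = m + n - j.+1 :> nat ->
  pipe (stage_black c i j) =
    (pipe (stage_black c i j.+1) * tperm x (pipe (stage_black c i j.+1) y))%g.
Proof.
move=> im jn cij xi yj; set c1 := stage_black c i j; set c2 := stage_black c i j.+1.
pose flt (d : nat -> nat -> bool) := filter (fun b : nat * nat => d b.1 b.2).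
pose l1 := flt c1 (rows_word 0 i ++ row_word i 0 j).
pose l2 := flt c1 (row_word i j.+1 (n - j.+1) ++ rows_word i.+1 (m - i.+1)).
have split_word d : word d = flt d (rows_word 0 i ++ row_word i 0 j) ++
    flt d [:: (i, j)] ++ flt d (row_word i j.+1 (n - j.+1) ++ rows_word i.+1 (m - i.+1)).
  rewrite /word (rows_word_split im) (row_word_split i jn) -!filter_cat.
  by rewrite -!catA.
have w1 : word c1 = l1 ++ l2.
  rewrite split_word /flt /= /c1 /stage_black (negPf cij) !ltnn eqxx /=.
  by [].
have w2 : word c2 = l1 ++ (i, j) :: l2.
  rewrite split_word /flt /= /c2 /stage_black ltnn eqxx ltnSn !orbT /=.
  congr (_ ++ _ :: _); apply: eq_in_filter => b; rewrite mem_cat => /orP [].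
  - by move=> /rows_wordP [/andP [_ bi] _]; rewrite /c1 /stage_black; lia.
  - by move=> /row_wordP [-> bj]; rewrite /c1 /stage_black; lia.
  - by move=> /row_wordP [-> bj]; rewrite /c1 /stage_black; lia.
  - by move=> /rows_wordP [bi _]; rewrite /c1 /stage_black; lia.
have l1in : {in l1, forall b, b.1 < m /\ b.2 < n}.
  by move=> b bl; apply: (@word_in c1); rewrite w1 mem_cat bl.
have l2in : {in l2, forall b, b.1 < m /\ b.2 < n}.
  by move=> b bl; apply: (@word_in c1); rewrite w1 mem_cat bl orbT.
have pd : m - i + j < m + n by lia.
have p'd : (m - i + j).-1 < m + n by lia.
have l2y : wordp l2 (rev_ord y) = (m - i + j).-1 :> nat.
  rewrite wordpE //= yj (_ : m + n - (m + n - j.+1).+1 = j); last by lia.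
  rewrite /l2 /flt filter_cat act_nat_cat.
  rewrite [[seq b <- rows_word _ _ | _]](_ : _ = rows_word i.+1 (m - i.+1)).
    rewrite rows_word_up //; last by lia.
    rewrite (_ : m - i.+1 + j = (m - i + j).-1); last by lia.
    rewrite act_nat_fix // => b; rewrite mem_filter => /andP [_ /row_wordP [b1 b2]].
    by rewrite /box_index b1; lia.
  apply/all_filterP/allP => b /rows_wordP [bi _]; rewrite /c1 /stage_black; lia.
have l1x : omega (wordp l1 (Ordinal p'd)) = x.
  apply: val_inj; rewrite /= omegaE wordpE //=.
  rewrite /l1 /flt filter_cat act_nat_cat.
  rewrite [[seq b <- row_word _ _ _ | _]](_ : _ = row_word i 0 j).
    rewrite row_word_left // act_nat_fix; first by rewrite xi; case: ifP; lia.
    move=> b; rewrite mem_filter => /andP [_ /rows_wordP [bi _]].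
    by rewrite /box_index; lia.
  apply/all_filterP/allP => b /row_wordP [-> bj]; rewrite /c1 /stage_black; lia.
have pipe2 : pipe c2 = (perm (@rev_ord_inj (m + n)%N) * wordp l2
    * tperm (Ordinal p'd) (Ordinal pd) * (wordp l1 * omega))%g.
  rewrite /pipe w2 wordp_cat /= (@simple_transpE _ _ (Ordinal p'd) (Ordinal pd)) ?mulgA //.
  by rewrite /box_index /=; lia.
have -> : pipe c2 y = (wordp l1 * omega)%g (Ordinal pd).
  rewrite pipe2 !permM (permE (@rev_ord_inj _)).
  have -> : wordp l2 (rev_ord y) = Ordinal p'd by apply: val_inj.
  by rewrite tpermL.
have -> : x = (wordp l1 * omega)%g (Ordinal p'd) by rewrite permM l1x.
have -> : pipe c1 = (perm (@rev_ord_inj (m + n)%N) * wordp l2 * (wordp l1 * omega))%g.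
  by rewrite /pipe w1 wordp_cat !mulgA.
(* Both ends are images under the part [W] that acts after the deleted letter, so their
   transposition is the conjugate of that letter by [W]. *)
rewrite -tpermJ conjgE pipe2; move: (wordp l1 * omega)%g => W.
rewrite -!mulgA mulKVg.
by congr (_ * (_ * _))%g; rewrite mulgA tperm2 mul1g.
Qed.

End PipeDream.

Import Order.TTheory GRing.Theory Num.Theory.
Local Open Scope ring_scope.

(** * Linear representation of gammoids *)

Section Gammoid.
Variables (V : finType) (m : nat) (src : 'I_m -> V).
Implicit Types (e : rel V) (f : 'I_m -> V) (es : seq (V * V)).

Definition linked e f : Prop :=
  exists p : 'I_m -> seq V,
    (forall i, path e (src i) (p i) /\ last (src i) (p i) \in codom f) /\
    (forall i i', i != i' -> [disjoint src i :: p i & src i' :: p i']).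

Lemma eq_linked e e' f f' : e =2 e' -> f =1 f' -> linked e f -> linked e' f'.
Proof.
move=> ee ff [p [pP dP]]; exists p; split=> // i; have [pi li] := pP i.
by rewrite -(eq_path ee) -(eq_codom ff).
Qed.

(** Disjoint paths have distinct ends, so sending a path to an index of its end is an injection of
    ['I_m] into itself, hence a bijection. *)
Lemma linked_onto f (p : 'I_m -> seq V) :
    (forall i, last (src i) (p i) \in codom f) ->
    (forall i i', i != i' -> [disjoint src i :: p i & src i' :: p i']) ->
  injective f /\ forall k, exists i, last (src i) (p i) = f k.
Proof.
move=> lP dP; pose g i := iinv (lP i).
have fg i : f (g i) = last (src i) (p i) by rewrite /g f_iinv.
have last_inj i i' : last (src i) (p i) = last (src i') (p i') -> i = i'.
  move=> ll; apply/eqP/negPn/negP => /dP /disjointFr /(_ (mem_last _ _)).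
  by rewrite ll mem_last.
have g_inj : injective g by move=> i i' gg; apply: last_inj; rewrite -!fg gg.
have [g' gK g'K] := injF_bij g_inj.
split=> [k k' ff|k]; last by exists (g' k); rewrite -fg g'K.
by rewrite -(g'K k) -(g'K k') (last_inj (g' k) (g' k')) // -!fg !g'K.
Qed.

(** * Adding an edge whose head has no outgoing edge *)

Definition relabel f (b a : V) : 'I_m -> V := fun k => if f k == b then a else f k.

Definition edge_of es : rel V := fun x y => (x, y) \in es.

Section AddEdge.
Variables (es : seq (V * V)) (a b : V).
Hypotheses (neq_ab : a != b) (b_out : forall c, (b, c) \notin es).

Let e := edge_of es.
Let e' := edge_of (rcons es (a, b)).

Lemma edge_b y : e b y = false.
Proof. by rewrite /e /edge_of (negPf (b_out y)). Qed.

Lemma edge_rcons x y : e' x y = e x y || ((x == a) && (y == b)).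
Proof. by rewrite /e' /edge_of mem_rcons inE xpair_eqE orbC. Qed.

Lemma path_rcons_edge x p : path e' x p ->
  path e x p \/ exists p', [/\ p = rcons p' b, path e x p' & last x p' = a].
Proof.
elim/last_ind: p => [|p y IH]; first by left.
rewrite rcons_path => /andP [/IH [pe|[p' [-> _ _]]]]; last first.
  by rewrite last_rcons edge_rcons edge_b eq_sym (negPf neq_ab).
rewrite edge_rcons => /orP [ey|/andP [/eqP la /eqP ->]].
  by left; rewrite rcons_path pe.
by right; exists p.
Qed.

Lemma path_mem_last x p : path e x p -> b \in x :: p -> last x p = b.
Proof.
elim: p x => [|y p IH] x /=; first by rewrite inE => _ /eqP.
move=> /andP [xy pp]; rewrite inE => /orP [/eqP bx|]; last exact: IH.
by move: xy; rewrite -bx edge_b.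
Qed.

(* A path using the new edge ends with it, since no edge leaves b. *)
Lemma linked_rcons f : injective f ->
  linked e' f <-> linked e f \/ linked e (relabel f b a).
Proof.
move=> f_inj; split=> [[p [pP dP]]|].
  case: (boolP [forall i, path e (src i) (p i)]) => [/forallP pe|].
    by left; exists p; split=> // i; split=> //; case: (pP i).
  rewrite negb_forall => /existsP [i0 ne0]; right.
  have [/path_rcons_edge [|[p' [pi0 pe' la]]] lf0] := pP i0.
    by move=> pe; case/negP: ne0.
  have bP0 : b \in src i0 :: p i0.
    by rewrite pi0 -rcons_cons mem_rcons mem_head.
  have bN i : i != i0 -> b \notin src i :: p i.
    by move=> /dP; rewrite disjoint_sym => /disjointFr ->.
  (* By disjointness only [p i0] visits [b]; it loses its last vertex and now ends at [a]. *)
  exists (fun i => if i == i0 then p' else p i); split=> [i|i i' nii].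
    case: eqP => [->|/eqP ni]; last first.
      have [/path_rcons_edge [pe|[p2 [pi _ _]]] /codomP [k lk]] := pP i.
        split=> //; apply/codomP; exists k; rewrite /relabel -lk.
        case: eqP => // lb; have := bN i ni; rewrite -lb.
        by rewrite mem_last.
      have := bN i ni; rewrite pi -rcons_cons mem_rcons mem_head //.
    split=> //; rewrite la.
    have [k bk] : exists k, f k = b.
      by have /codomP [k] := lf0; rewrite pi0 last_rcons => ->; exists k.
    by apply/codomP; exists k; rewrite /relabel bk eqxx.
  have sub i2 : {subset src i2 :: (if i2 == i0 then p' else p i2)
                 <= src i2 :: p i2}.
    case: eqP => [->|_] z //; rewrite pi0 -rcons_cons mem_rcons => zp.
    by rewrite inE zp orbT.
  rewrite disjoint_subset; apply/subsetP=> z /sub zi; apply/negP => /sub zi'.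
  by have /disjointFr/(_ zi) := dP _ _ nii; rewrite zi'.
case=> [[p [pP dP]]|].
  exists p; split=> // i; have [pi li] := pP i; split=> //.
  by apply: sub_path pi => x y; rewrite edge_rcons => ->.
have [/codomP [k0 bk0]|nb] := boolP (b \in codom f); last first.
  case=> p [pP dP]; exists p; split=> // i; have [pi li] := pP i; split.
    by apply: sub_path pi => x y; rewrite edge_rcons => ->.
  rewrite -(@eq_codom _ _ (relabel f b a)) // => k; rewrite /relabel.
  by case: eqP => // fk; case/negP: nb; rewrite -fk codom_f.
case=> p [pP dP].
have [r_inj r_onto] := linked_onto (fun i => (pP i).2) dP.
have [i0 li0] := r_onto k0; have rk0 : relabel f b a k0 = a by rewrite /relabel -bk0 eqxx.
(* A path visiting [b] would end there, but [b] is no target after relabelling; hence the path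
   ending at [a] may be extended by [b]. *)
have bN i : b \notin src i :: p i.
  apply/negP => /(path_mem_last (pP i).1) lb; have := (pP i).2; rewrite lb.
  case/codomP=> k; rewrite /relabel; case: eqP => [_ ba|nfk fk].
    by move: neq_ab; rewrite ba eqxx.
  by rewrite fk in nfk.
exists (fun i => if i == i0 then rcons (p i0) b else p i); split=> [i|i i' nii].
  case: eqP => [->|/eqP ni].
    split; last by rewrite last_rcons bk0 codom_f.
    rewrite rcons_path li0 rk0 edge_rcons !eqxx orbT andbT; apply: sub_path (pP i0).1 => x y.
    by rewrite edge_rcons => ->.
  have [pi /codomP [k lk]] := pP i; split.
    by apply: sub_path pi => x y; rewrite edge_rcons => ->.
  rewrite lk /relabel; case: eqP => [fk|_]; last exact: codom_f.
  have := dP _ _ ni; move=> /disjointFr /(_ (mem_last _ _)).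
  by rewrite lk /relabel fk eqxx -rk0 -li0 mem_last.
have sub i2 z : z \in src i2 :: (if i2 == i0 then rcons (p i0) b else p i2) ->
    z \in src i2 :: p i2 \/ i2 = i0 /\ z = b.
  case: eqP => [->|_]; last by left.
  by rewrite -rcons_cons mem_rcons inE => /orP [/eqP|]; [right|left].
rewrite disjoint_subset; apply/subsetP => z zi; apply/negP => zi'.
have [{}zi|[ii zb]] := sub _ _ zi; have [{}zi'|[ii' zb']] := sub _ _ zi'.
- by have := dP _ _ nii; move=> /disjointFr /(_ zi); rewrite zi'.
- by case/negP: (bN i); rewrite -zb'.
- by case/negP: (bN i'); rewrite -zb.
- by rewrite ii ii' eqxx in nii.
Qed.

End AddEdge.

(** * Determinants of families of vertices and generic weights *)

Definition det_of (u : V -> 'rV[rat]_m) f := \det (\matrix_k u (f k)).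

Lemma eq_det_of u u' f f' : (forall k, u (f k) = u' (f' k)) ->
  det_of u f = det_of u' f'.
Proof. by move=> uf; congr (\det _); apply/row_matrixP=> k; rewrite !rowK. Qed.

Lemma det_of_inj u f : det_of u f != 0 -> injective f.
Proof.
move=> Df k k' ff; apply/eqP/negPn/negP => nkk; case/negP: Df; apply/eqP.
apply: (determinant_alternate nkk) => j.
by rewrite !mxE ff.
Qed.

Lemma relabel_id f b a : b \notin codom f -> relabel f b a =1 f.
Proof.
by move=> nb k; rewrite /relabel; case: eqP => // fk; rewrite -fk codom_f in nb.
Qed.

Lemma linked_inj e f : linked e f -> injective f.
Proof. by case=> p [pP dP]; case: (linked_onto (fun i => (pP i).2) dP). Qed.

(** An injective [f] has at most one row at [b], and the determinant is linear in that row;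
    [relabel] puts the vector of [a] there. *)
Lemma det_of_add u a b s f : a != b -> injective f ->
  det_of (fun x => if x == b then u b + s *: u a else u x) f =
    det_of u f + (if b \in codom f then s * det_of u (relabel f b a) else 0).
Proof.
move=> neq_ab f_inj; have [/codomP [k0 bk0]|nb] := boolP (b \in codom f).
  rewrite -[det_of u f]mul1r; apply: (@determinant_multilinear _ _ _ _ _ k0).
  - by rewrite !rowK -bk0 eqxx /relabel -bk0 eqxx scale1r.
  - apply/row_matrixP=> k; rewrite !row_rowsub !rowK /=; case: eqP => // fk.
    by have := neq_lift k0 k; rewrite -(inj_eq f_inj) -bk0 -fk eqxx.
  - apply/row_matrixP=> k; rewrite !row_rowsub !rowK /relabel /=; case: eqP => // fk.
    by have := neq_lift k0 k; rewrite -(inj_eq f_inj) -bk0 -fk eqxx.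
rewrite addr0; apply: eq_det_of => k; case: eqP => // fk.
by rewrite -fk codom_f in nb.
Qed.

(** Only zero and the finitely many roots [- x i / y i] have to be avoided, and the rationals are
    infinite. *)
Lemma generic_scalar (T : finType) (x y : T -> rat) :
  exists2 s, s != 0 & forall i, (x i != 0) || (y i != 0) -> x i + s * y i != 0.
Proof.
have notin (l : seq rat) : exists s, s \notin l.
  exists (1 + \sum_(z <- l) `|z|); apply/negP => sl.
  have : 1 + \sum_(z <- l) `|z| <= \sum_(z <- l) `|z|.
    rewrite {2}(big_rem _ sl) /= ger0_norm ?lerDl ?sumr_ge0 //.
    by rewrite addr_ge0 ?sumr_ge0.
  by rewrite gerDr.
have [s] := notin (0 :: [seq - x i / y i | i : T]).
rewrite inE negb_or => /andP [s0 sN]; exists s => // i.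
have [-> /=|yi _] := eqVneq (y i) 0; first by rewrite orbF mulr0 addr0.
apply: contra sN => /eqP xy; apply/imageP; exists i => //.
by apply: (mulIf yi); rewrite divfK //; apply/eqP; rewrite -addr_eq0 addrC xy.
Qed.

(* The edges are added by increasing height of their heads, so that the vector of
   a vertex is final before an edge leaving it is used; each new weight avoids the
   finitely many values killing a determinant that should not vanish. *)
Lemma gammoid_representation (rk : V -> nat) es : injective src -> uniq es ->
    (forall x y, (x, y) \in es -> (rk x < rk y)%N) ->
    sorted (fun x y => rk x.2 <= rk y.2)%N es ->
  exists (u : V -> 'rV[rat]_m) (t : V -> V -> rat),
    [/\ forall x y, t x y != 0,
        forall w, u w = \sum_(k | src k == w) delta_mx 0 k
                        + \sum_(p | (p, w) \in es) t p w *: u p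
      & forall f, det_of u f != 0 <-> linked (edge_of es) f].
Proof.
move=> src_inj; elim/last_ind: es => [_ _ _|es [a b] IH].
  exists (fun w => \sum_(k | src k == w) delta_mx 0 k), (fun _ _ => 1).
  split=> // [w|f]; first by rewrite big_pred0_eq addr0.
  have srcE k : \sum_(k' | src k' == src k) delta_mx 0 k' = delta_mx 0 k :> 'rV[rat]_m.
    by rewrite (eq_bigl _ _ (fun k' => inj_eq src_inj k' k)) big_pred1_eq.
  split=> [Df|[p [pP dP]]].
    have fs k : f k \in codom src.
      apply/negPn/negP => nfk; case/negP: Df; apply/eqP.
      rewrite /det_of (expand_det_row _ k) big1 // => j _.
      rewrite mxE big_pred0 ?mxE ?mul0r // => k'.
      by apply/eqP => sf; case/negP: nfk; rewrite -sf codom_f.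
    exists (fun=> [::]); split=> [i|i i' nii].
      split=> //=.
      have f_inj := det_of_inj Df; pose g k := iinv (fs k).
      have sg k : src (g k) = f k by rewrite /g f_iinv.
      have [g' gK g'K] : bijective g.
        by apply: injF_bij => k k' gg; apply: f_inj; rewrite -!sg gg.
      by apply/codomP; exists (g' i); rewrite -sg g'K.
    rewrite disjoint_has /= orbF inE; apply: contra nii => /eqP /src_inj ->.
    by rewrite eqxx.
  have [f_inj f_onto] := linked_onto (fun i => (pP i).2) dP.
  (* Without edges all paths are empty, so [f] lists the sources in some order and the matrix is a
     permutation matrix. *)
  have p0 i : p i = [::] by case: (p i) (pP i) => [|y l] [] //=; rewrite /edge_of.
  have /fin_all_exists [g gf] : forall k, exists i, src i = f k.
    by move=> k; have [i] := f_onto k; rewrite p0; exists i.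
  have g_inj : injective g by move=> k k' gg; apply: f_inj; rewrite -!gf gg.
  have -> : det_of (fun w => \sum_(k | src k == w) delta_mx 0 k) f
          = \det (perm_mx (perm g_inj) : 'M[rat]_m).
    congr (\det _); apply/row_matrixP=> k; rewrite rowK -gf srcE.
    by apply/rowP=> j; rewrite !mxE permE eqxx eq_sym.
  by rewrite det_perm signr_eq0.
rewrite rcons_uniq => /andP [abN es_uniq] es_rk es_sorted.
have es_rk' x y : (x, y) \in es -> (rk x < rk y)%N.
  by move=> xy; apply: es_rk; rewrite mem_rcons inE xy orbT.
have leq_tr : transitive (fun x y : V * V => rk x.2 <= rk y.2)%N.
  by move=> x y z; apply: leq_trans.
move: es_sorted; rewrite sorted_pairwise // pairwise_rcons => /andP [es_le es_pw].
have rk_ab : (rk a < rk b)%N by apply: es_rk; rewrite mem_rcons mem_head.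
have neq_ab : a != b by apply: contraTneq rk_ab => ->; rewrite ltnn.
(* An edge leaving [b] would have a head higher than [b], but the new edge has a head of maximal
   height. *)
have b_out c : (b, c) \notin es.
  apply/negP => bc; have := es_rk' _ _ bc; rewrite ltnNge => /negP [].
  by have /allP/(_ _ bc) := es_le.
have [|u [t [t0 uE uP]]] := IH es_uniq es_rk'; first by rewrite sorted_pairwise.
pose y f := if b \in codom f then det_of u (relabel f b a) else 0.
(* One scalar must serve all families at once; as finite functions they form a finite type, so the
   conditions are finite in number. *)
have [s s0 sP] := @generic_scalar {ffun 'I_m -> V} (fun g => det_of u g) (fun g => y g).
exists (fun x => if x == b then u b + s *: u a else u x).
exists (fun p w => if (p == a) && (w == b) then s else t p w).
split=> [p w|w|f].
- by case: ifP.
- have pNb p c : (p, c) \in es -> (p == b) = false.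
    by move=> pw; apply: contraTF pw => /eqP ->.
  have uNb c : u c = \sum_(k | src k == c) delta_mx 0 k
      + \sum_(p | (p, c) \in es) t p c *: (if p == b then u b + s *: u a else u p).
    by rewrite uE; congr (_ + _); apply: eq_bigr => p /pNb ->.
  case: (eqVneq w b) => [->|nwb].
    rewrite [RHS]/= (bigD1 a) /=; last by rewrite mem_rcons mem_head.
    rewrite !eqxx (negPf neq_ab) addrCA addrC; congr (_ + _).
    rewrite {1}uNb; congr (_ + _); apply: eq_big => [p|p pb].
      rewrite mem_rcons inE xpair_eqE eqxx andbT; case: (eqVneq p a) => [->|].
        by rewrite (negPf abN).
      by rewrite andbT.
    by case: (eqVneq p a) pb => // ->; rewrite (negPf abN).
  rewrite uNb; congr (_ + _); apply: eq_big => [p|p _].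
    by rewrite mem_rcons inE xpair_eqE (negPf nwb) andbF.
  by rewrite andbF.
have [f_inj|Nf_inj] := pselect (injective f); last first.
  by split=> [/det_of_inj|/linked_inj].
rewrite linked_rcons // -!uP det_of_add //.
have fE : det_of u f + (if b \in codom f then s * det_of u (relabel f b a) else 0)
    = det_of u (finfun f) + s * y (finfun f).
  rewrite (eq_det_of (u' := u) (f' := finfun f)); last by move=> k; rewrite ffunE.
  congr (_ + _); rewrite /y (eq_codom (ffunE f)); case: ifP => _; last by rewrite mulr0.
  by congr (_ * _); apply: eq_det_of => k; rewrite /relabel ffunE.
have df : det_of u (finfun f) = det_of u f.
  by apply: eq_det_of => k; rewrite ffunE.
have yf : (y (finfun f) != 0) = (det_of u (relabel f b a) != 0) && (b \in codom f).
  rewrite /y (eq_codom (ffunE f)) andbC; case: ifP => //= _.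
  by congr (_ != 0); apply: eq_det_of => k; rewrite /relabel ffunE.
split=> [Dne|DD].
  have [df0|] := eqVneq (det_of u f) 0; last by left.
  right; move: Dne; rewrite fE df df0 add0r mulf_eq0 negb_or s0 /=.
  by rewrite yf => /andP [].
rewrite fE; apply: sP; rewrite df yf.
have [bf|/relabel_id re] := boolP (b \in codom f).
  by rewrite andbT; apply/orP.
suff -> : det_of u f != 0 by [].
case: DD => //.
by rewrite (eq_det_of (u' := u) (f' := f)) // => k; rewrite re.
Qed.

End Gammoid.

(** * Spans of intervals of labels *)

Section Spans.
Variables (F : fieldType) (m d : nat).
Implicit Types (U : 'I_d -> 'rV[F]_m) (P Q : pred 'I_d).

Definition row_span U P : 'M[F]_m := (\sum_(z | P z) <<U z>>)%MS.

Lemma row_span_sub p U P (A : 'M_(p, m)) :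
  reflect (forall z, P z -> (U z <= A)%MS) (row_span U P <= A)%MS.
Proof.
by apply: (iffP sumsmx_subP) => PA z /PA; rewrite genmxE.
Qed.

Lemma mem_row_span U P z : P z -> (U z <= row_span U P)%MS.
Proof. by move=> Pz; apply: (sumsmx_sup z); rewrite ?genmxE. Qed.

Lemma eq_row_span U U' P P' : P =1 P' -> (forall z, P z -> U z = U' z) ->
  row_span U P = row_span U' P'.
Proof. by move=> PP UU; apply: eq_big => // z /UU ->. Qed.

Lemma row_span_subset U P P' : subpred P P' -> (row_span U P <= row_span U P')%MS.
Proof. by move=> PP; apply/row_span_sub => z /PP; apply: mem_row_span. Qed.

Lemma sub_row_span U P P' (x : 'rV[F]_m) : subpred P P' ->
  (x <= row_span U P)%MS -> (x <= row_span U P')%MS.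
Proof. by move=> /(@row_span_subset U) PP xP; apply: submx_trans PP. Qed.

(** The coefficient of [v] is read off at coordinate [k], where everything else vanishes; it is
    therefore zero. *)
Lemma coord_sub p k (v x : 'rV[F]_m) (A : 'M_(p, m)) : v 0 k != 0 -> x 0 k = 0 ->
  (forall i, A i k = 0) -> (x <= v + A)%MS -> (x <= A)%MS.
Proof.
move=> vk xk Ak /sub_addsmxP [[D E] /= xE].
have DE : D = (D 0 0)%:M by rewrite -mx11_scalar.
have := congr1 (fun y : 'rV_m => y 0 k) xE.
rewrite xk DE mul_scalar_mx !mxE big1 => [|i _]; last by rewrite Ak mulr0.
rewrite addr0 => /esym/eqP; rewrite mulf_eq0 (negPf vk) orbF => /eqP D0.
by rewrite xE DE D0 raddf0 mul0mx add0r submxMl.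
Qed.

Lemma row_span_coord U P k : (forall z, P z -> U z 0 k = 0) -> forall i, row_span U P i k = 0.
Proof.
move=> Pk i.
have /row_subP /(_ i) : (row_span U P <= kermx (delta_mx k 0 : 'cV[F]_m))%MS.
  apply/row_span_sub => z /Pk zk; apply/sub_kermxP; apply/matrixP => i' j'.
  by rewrite -colE !mxE !ord1.
by move/sub_kermxP/matrixP/(_ 0 0); rewrite -colE !mxE.
Qed.

Lemma coord_sub_row_span U P k (v x : 'rV[F]_m) : v 0 k != 0 -> x 0 k = 0 ->
  (forall z, P z -> U z 0 k = 0) -> (x <= v + row_span U P)%MS -> (x <= row_span U P)%MS.
Proof. by move=> vk xk Pk; apply: coord_sub vk xk _; apply: row_span_coord. Qed.

(** Steinitz exchange: the coefficient of [v] is nonzero, so the relation can be solved for [v]. *)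
Lemma sub_exchange p (v x : 'rV[F]_m) (A : 'M_(p, m)) :
  (x <= v + A)%MS -> ~~ (x <= A)%MS -> (v <= x + A)%MS.
Proof.
move=> /sub_addsmxP [[D E] /= xE].
have DE : D = (D 0 0)%:M by rewrite -mx11_scalar.
have [D0|D0 _] := eqVneq (D 0 0) 0.
  by rewrite xE DE D0 raddf0 mul0mx add0r submxMl.
move: xE; rewrite DE mul_scalar_mx => /(congr1 (fun y => (D 0 0)^-1 *: (y - E *m A))).
rewrite addrK scalerA mulVf // scale1r => <-.
rewrite scalemx_sub // addmx_sub ?addsmxSl //.
by rewrite eqmx_opp (submx_trans (submxMl _ _)) ?addsmxSr.
Qed.

Lemma row_span_split U P b : (row_span U P <= U b + row_span U (fun z => P z && (z != b)))%MS.
Proof.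
apply/row_span_sub => z Pz; have [->|nz] := eqVneq z b; first exact: addsmxSl.
by apply: submx_trans (addsmxSr _ _); apply: mem_row_span; rewrite Pz.
Qed.

Definition icol s (x : nat) : pred 'I_d := fun z => (s <= z < x)%N.
Definition irow s (x : nat) : pred 'I_d := fun z => (s <= z)%N || (z < x)%N.

(* Labels below m are rows (those below r are processed), the others are columns.
   The cyclic interval of labels from s to x - 1 is icol s x if s <= x and irow s x
   otherwise; the two remaining cases, a column with x < s and a row with s <= x,
   follow from these. *)
Record necklace_inv (r : nat) U (g : 'S_d) : Prop := NecklaceInv {
  inv_col : forall (x : 'I_d) s, (m <= x)%N -> (s <= x)%N ->
    (U x <= row_span U (icol s x))%MS = (s <= (g^-1)%g x)%N;
  inv_row : forall (x : 'I_d) s, (x < r)%N -> (x < s)%N ->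
    (U x <= row_span U (irow s x))%MS = (s <= (g^-1)%g x)%N;
  inv_le : forall x : 'I_d, (m <= x)%N -> ((g^-1)%g x <= x)%N;
  inv_ge : forall x : 'I_d, (x < m)%N -> (x <= (g^-1)%g x)%N;
  inv_loop : forall x : 'I_d, (r <= x < m)%N -> U x = 0 /\ g x = x }.

(** The zero vector lies in the span of the empty interval from [x] to [x], which bounds [g^-1 x]
    below by [x]; [inv_le] is the opposite bound. *)
Lemma inv_zero r U g (x : 'I_d) : necklace_inv r U g -> (m <= x)%N -> U x = 0 ->
  g x = x.
Proof.
move=> [Hc _ Hle _ _] mx Ux; have := Hc x x mx (leqnn _).
rewrite Ux sub0mx => /esym xg; have : (g^-1)%g x = x.
  by apply/val_inj/anti_leq; rewrite Hle.
by move=> {1}<-; rewrite permKV.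
Qed.

(* [a] carries the current row [i], and all labels between [a] and [b] are loops. *)
Section Bridge.
Variables (U U' : 'I_d -> 'rV[F]_m) (g : 'S_d) (i a b : 'I_d) (k : 'I_m) (s t : F).
Hypotheses (inv : necklace_inv i.+1 U g) (lt_im : (i < m)%N) (le_mb : (m <= b)%N)
  (lt_ab : (a < b)%N) (ai : a = i \/ (m <= a)%N) (ga : g a = i)
  (between : forall z : 'I_d, (a < z < b)%N -> (m <= z)%N -> U z = 0)
  (Uak : U a 0 k != 0) (Ubk : forall z : 'I_d, (b <= z)%N -> U z 0 k = 0)
  (Uik : forall z : 'I_d, (z < i)%N -> U z 0 k = 0)
  (t_neq0 : t != 0) (s_neq0 : s != 0)
  (U'b : U' b = s *: U b + t *: U a) (U'E : forall z, z != b -> U' z = U z).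

Let y := g b.
(** The values [a] and [b] of [g^-1] at [i] and [y] are exchanged, the others kept. *)
Let g' := (g * tperm i y)%g.

Local Lemma le_ia : (i <= a)%N.
Proof. by case: ai => [->|ma] //; apply: leq_trans ma; apply: ltnW. Qed.

Local Lemma neq_ab : a != b.
Proof. by apply: contraTneq lt_ab => ->; rewrite ltnn. Qed.

Local Lemma gVi : (g^-1)%g i = a.
Proof. by rewrite -ga permK. Qed.

Local Lemma gVy : (g^-1)%g y = b.
Proof. by rewrite permK. Qed.

Local Lemma neq_yi : y != i.
Proof. by rewrite -ga (inj_eq perm_inj) eq_sym neq_ab. Qed.

Local Lemma g'Vi : (g'^-1)%g i = b.
Proof. by rewrite /g' invMg permM tpermV tpermL gVy. Qed.

Local Lemma g'Vy : (g'^-1)%g y = a.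
Proof. by rewrite /g' invMg permM tpermV tpermR gVi. Qed.

Local Lemma g'V x : x != i -> x != y -> (g'^-1)%g x = (g^-1)%g x.
Proof. by move=> xi xy; rewrite /g' invMg permM tpermV tpermD // eq_sym. Qed.

Local Lemma y_col : (m <= y)%N -> (b <= y)%N.
Proof. by move=> my; have := inv_le inv my; rewrite gVy. Qed.

(** Rows after [i] are fixed by [g], so none of them is the image of the column [b]; and [y] is not
    [i]. *)
Local Lemma y_row : (y < m)%N -> (y < i)%N.
Proof.
move=> ym; rewrite ltnNge; apply/negP => iy.
have [|_ gy] := inv_loop inv (x := y).
  by rewrite ym andbT ltn_neqAle iy andbT eq_sym; apply: neq_yi.
by have := perm_inj gy; move: ym => /[swap] ->; rewrite ltnNge le_mb.
Qed.

Local Lemma between_loop (z : 'I_d) : (a < z < b)%N -> U z = 0 /\ (g^-1)%g z = z.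
Proof.
move=> zab; have [U0 gz] : U z = 0 /\ g z = z; last first.
  by split=> //; rewrite -{1}gz permK.
case: (ltnP z m) => [zm|mz].
  by apply: (inv_loop inv); rewrite zm andbT; have := le_ia; lia.
by have U0 := between zab mz; rewrite (inv_zero inv mz).
Qed.

Local Lemma U'bk : U' b 0 k != 0.
Proof. by rewrite U'b !mxE Ubk // mulr0 add0r mulf_neq0. Qed.

Local Lemma row_spanE P : P b = false -> row_span U' P = row_span U P.
Proof.
move=> Pb; apply: eq_row_span => // z Pz; apply: U'E.
by apply: contraTneq Pz => ->; rewrite Pb.
Qed.

(** With [U a] present, replacing [U b] is an elementary row operation, invertible because [s] is
    nonzero. *)
Local Lemma row_spanE' P : P a -> P b -> (row_span U' P :=: row_span U P)%MS.
Proof.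
move=> Pa Pb; apply/eqmxP/andP; split; apply/row_span_sub => z Pz.
  have [->|nzb] := eqVneq z b; last by rewrite U'E // mem_row_span.
  by rewrite U'b addmx_sub ?scalemx_sub ?mem_row_span.
have [->|nzb] := eqVneq z b; last by rewrite -U'E // mem_row_span.
have -> : U b = s^-1 *: (U' b - t *: U' a).
  by rewrite U'b (U'E neq_ab) addrK scalerA mulVf // scale1r.
by rewrite scalemx_sub // addmx_sub ?eqmx_opp ?scalemx_sub ?mem_row_span.
Qed.

(** An interval missing [b], or containing both [a] and [b], keeps its span. If it starts in
    [(a, b]] and goes past [b], then [U' b] is its only vector with a nonzero coordinate [k], hence
    of no help for [x], and the labels before [b] are loops: it might as well start after [b]. *)
Lemma bridge_col (x : 'I_d) e : (m <= x)%N -> (e <= x)%N ->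
  (U' x <= row_span U' (icol e x))%MS = (e <= (g'^-1)%g x)%N.
Proof.
move=> mx ex; have nxi : x != i.
  by apply: contraTneq mx => ->; rewrite -ltnNge.
have [ltxb|ltbx|/val_inj xb] := ltngtP x b.
- have nxb : x != b by apply: contraTneq ltxb => ->; rewrite ltnn.
  have nxy : x != y.
    by apply: contraTneq ltxb => xy; rewrite -leqNgt xy y_col // -xy.
  rewrite g'V // U'E // row_spanE; first exact: (inv_col inv).
  by rewrite /icol; lia.
- have nxb : x != b by apply: contraTneq ltbx => ->; rewrite ltnn.
  rewrite U'E //; have := inv_col inv mx ex.
  have [ltbe|leeb] := ltnP b e.
    rewrite row_spanE; last by rewrite /icol; lia.
    move=> ->; have [->|nxy] := eqVneq x y; last by rewrite g'V.
    by rewrite g'Vy gVy; lia.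
  have [leea|ltae] := leqP e a.
    rewrite row_spanE'; [|by rewrite /icol; lia|by rewrite /icol; lia].
    move=> ->; have [->|nxy] := eqVneq x y; last by rewrite g'V.
    by rewrite g'Vy gVy; lia.
  move=> _; transitivity (b < (g^-1)%g x)%N.
    rewrite -(inv_col inv (s := b.+1)) //; apply/idP/idP => [xe|].
      apply: (coord_sub_row_span U'bk) => //; first exact/Ubk/ltnW.
        by move=> z; rewrite /icol => bz; apply: Ubk; lia.
      apply: submx_trans xe _; apply/row_span_sub => z; rewrite /icol => ez.
      have [->|nzb] := eqVneq z b; first exact: addsmxSl.
      rewrite U'E //; have [|ltbz] := leqP z b.
        rewrite leq_eqVlt (negPf nzb : (z == b :> nat) = false) /= => zb.
        by rewrite (between_loop _).1 ?sub0mx //; lia.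
      by apply: submx_trans (addsmxSr _ _); apply: mem_row_span; rewrite /icol; lia.
    rewrite -(@row_spanE (icol b.+1 x)); last by rewrite /icol ltnn.
    by apply: sub_row_span => z; rewrite /icol; lia.
  have [->|nxy] := eqVneq x y; first by rewrite g'Vy gVy ltnn; lia.
  (* Loops are fixed by [g], so [g^-1 x] is not strictly between [a] and [b], and comparing it with
     [e] or with [b] gives the same answer. *)
  rewrite g'V //; have : (g^-1)%g x != a by rewrite -gVi (inj_eq perm_inj).
  have : (g^-1)%g x != b by rewrite -gVy (inj_eq perm_inj).
  rewrite -!val_eqE /=; case: (ltnP a ((g^-1)%g x)) => [az|]; last by lia.
  case: (ltnP ((g^-1)%g x) b) => [zb|]; last by lia.
  have azb : (a < (g^-1)%g x < b)%N by rewrite az.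
  by have [_ /perm_inj zx] := between_loop azb; move: zb; rewrite zx; lia.
- rewrite {x}xb in mx ex nxi *.
  have [leea|ltae] := leqP e a.
    have Pa : icol e b a by rewrite /icol leea.
    have := inv_col inv mx ex; rewrite row_spanE; last by rewrite /icol ltnn andbF.
    have -> : (e <= (g'^-1)%g b)%N = (e <= (g^-1)%g b)%N.
      have [by_|nby] := eqVneq b y; last by rewrite g'V.
      by rewrite {1}by_ g'Vy [in RHS]by_ gVy; lia.
    move=> <-; apply/idP/idP => [bP|bP].
      have -> : U b = s^-1 *: (U' b - t *: U a).
        by rewrite U'b addrK scalerA mulVf // scale1r.
      by rewrite scalemx_sub // addmx_sub ?eqmx_opp ?scalemx_sub ?mem_row_span.
    by rewrite U'b addmx_sub ?scalemx_sub ?(mem_row_span _ Pa).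
  (* The interval now consists of loops, which cannot span the nonzero vector [U' b]. *)
  rewrite [RHS](_ : _ = false).
    apply/negbTE/negP => bP; have : (U' b <= (0 : 'M_m))%MS.
      apply: submx_trans bP _; apply/row_span_sub => z; rewrite /icol => ez.
      by rewrite U'E ?(between_loop _).1 ?sub0mx //; [lia|rewrite -val_eqE /=; lia].
    by rewrite submx0 => /eqP b0; move: U'bk; rewrite b0 mxE eqxx.
  have [by_|nby] := eqVneq b y; first by rewrite {1}by_ g'Vy; lia.
  rewrite g'V //; have := inv_le inv mx; set z := (g^-1)%g b => zb.
  have nza : z != a by rewrite -gVi (inj_eq perm_inj).
  have nzb : z != b.
    by apply: contra nby => /eqP zb'; rewrite /y -{2}zb' permKV.
  case: (ltnP a z) => az; last by lia.
  have azb : (a < z < b)%N by rewrite -val_eqE /= in nzb; lia.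
  by have [_ /perm_inj gz] := between_loop azb; rewrite gz eqxx in nzb.
Qed.

Local Lemma gVbtw (x : 'I_d) : x != i -> x != y -> (x <= a)%N || (b < x)%N ->
  ~~ (a < (g^-1)%g x <= b)%N.
Proof.
move=> nxi nxy xab; apply/negP => /andP [az zb].
have : (g^-1)%g x != b by rewrite -gVy (inj_eq perm_inj).
rewrite -val_eqE /= => nzb.
have azb : (a < (g^-1)%g x < b)%N by rewrite az ltn_neqAle nzb.
by have [_ /perm_inj zx] := between_loop azb; move: azb; rewrite zx; lia.
Qed.

(** Since [g^-1 y] is [b], the vector [U y] is spanned from the start [b] but not from [b + 1], so
    [U b] can be exchanged for [U y]. All labels used lie cyclically after [b] and before [i], as
    [y] is a column from [b] on or a row before [i]; if [y] is [b], then [U b] is zero. *)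
Local Lemma Ub_span : (U b <= row_span U (irow b.+1 i))%MS.
Proof.
have [my|ym] := leqP m y.
  have leby := y_col my; have := inv_col inv my leby; rewrite gVy leqnn => yP.
  have [yb|nyb] := eqVneq y b.
    by move: yP; rewrite yb; apply: sub_row_span => z; rewrite /icol; lia.
  have ltby : (b < y)%N by rewrite -val_eqE /= in nyb; lia.
  have := inv_col inv my ltby; rewrite gVy ltnn => yN.
  have yP' : (U y <= U b + row_span U (icol b.+1 y))%MS.
    apply: submx_trans yP (submx_trans (row_span_split _ _ b) (addsmxS (submx_refl _) _)).
    by apply: row_span_subset => z; rewrite /icol -val_eqE /=; lia.
  apply: submx_trans (sub_exchange yP' (negbT yN)) _.
  rewrite addsmx_sub mem_row_span /=; last by rewrite /irow ltby.
  by apply: row_span_subset => z; rewrite /icol /irow; lia.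
have ltyi := y_row ym.
have := inv_row inv (leq_trans ltyi (leqnSn i))
  (leq_trans ltyi (leq_trans le_ia (ltnW lt_ab))).
rewrite gVy leqnn => yP.
have := @inv_row _ _ _ inv y b.+1 (leq_trans ltyi (leqnSn i)).
rewrite gVy ltnn => /(_ _) yN.
have {}yN : ~~ (U y <= row_span U (irow b.+1 y))%MS by rewrite yN //; lia.
have yP' : (U y <= U b + row_span U (irow b.+1 y))%MS.
  apply: submx_trans yP (submx_trans (row_span_split _ _ b) (addsmxS (submx_refl _) _)).
  by apply: row_span_subset => z; rewrite /irow -val_eqE /=; lia.
apply: submx_trans (sub_exchange yP' yN) _.
rewrite addsmx_sub mem_row_span /=; last by rewrite /irow ltyi orbT.
by apply: row_span_subset => z; rewrite /irow; lia.
Qed.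

Lemma bridge_row (x : 'I_d) e : (x < i.+1)%N -> (x < e)%N ->
  (U' x <= row_span U' (irow e x))%MS = (e <= (g'^-1)%g x)%N.
Proof.
have le_ia := le_ia; move=> xi xe; have ltxb : (x < b)%N by lia.
have nxb : x != b by apply: contraTneq ltxb => ->; rewrite ltnn.
rewrite U'E //; have := inv_row inv xi xe.
have [ltbe|leeb] := ltnP b e.
  rewrite row_spanE => [->|]; last by rewrite /irow; lia.
  have [->|nxi] := eqVneq x i; first by rewrite g'Vi gVi; lia.
  have [->|nxy] := eqVneq x y; last by rewrite g'V.
  by rewrite g'Vy gVy; lia.
have [leea|ltae] := leqP e a.
  rewrite row_spanE' => [->||]; [|by rewrite /irow; lia|by rewrite /irow; lia].
  have [->|nxi] := eqVneq x i; first by rewrite g'Vi gVi; lia.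
  have [->|nxy] := eqVneq x y; last by rewrite g'V.
  by rewrite g'Vy gVy; lia.
move=> _; have [xi'|nxi] := eqVneq x i.
  rewrite xi' g'Vi leeb.
  have subZ (A : 'rV[F]_m) : (A <= row_span U (irow b.+1 i))%MS ->
      (A <= row_span U' (irow e i))%MS.
    rewrite -(@row_spanE (irow b.+1 i)); last by rewrite /irow; lia.
    by apply: sub_row_span => z; rewrite /irow; lia.
  (* [U a] is recovered from [U' b] and [U b]. Hence whatever was spanned from the start [a], in
     particular [U i], is now spanned from [b]: the threshold of row [i] moves from [a] to [b]. *)
  have UaZ : (U a <= row_span U' (irow e i))%MS.
    have -> : U a = t^-1 *: (U' b - s *: U b).
      by rewrite U'b [s *: U b + _]addrC addrK scalerA mulVf // scale1r.
    rewrite scalemx_sub // addmx_sub ?eqmx_opp ?scalemx_sub //.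
      by apply: mem_row_span; rewrite /irow leeb.
    exact: (subZ _ Ub_span).
  case: ai => [ai_|ma]; first by rewrite -{1}ai_.
  have := @inv_row _ _ _ inv i a (ltnSn i); rewrite gVi leqnn => iP.
  have {}iP : (U i <= row_span U (irow a i))%MS by apply: iP; apply: leq_trans ma.
  apply: submx_trans iP _; apply/row_span_sub => z; rewrite /irow => az.
  have [->//|nza] := eqVneq z a; have [->|nzb] := eqVneq z b; first exact: (subZ _ Ub_span).
  have [zab|nzab] := boolP (a < z < b)%N; first by rewrite (between_loop zab).1 sub0mx.
  apply: subZ; apply: mem_row_span; rewrite /irow.
  by move: nza nzb nzab; rewrite -!val_eqE /=; lia.
have ltxi : (x < i)%N by rewrite ltn_neqAle nxi.
transitivity (b < (g^-1)%g x)%N.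
  rewrite -(inv_row inv (s := b.+1)) //; last by lia.
  apply/idP/idP => [xP|].
    apply: (coord_sub_row_span U'bk) => //; first exact/Uik.
      by move=> z; rewrite /irow => /orP [bz|zx]; [apply/Ubk/ltnW|apply: Uik; lia].
    apply: submx_trans xP _; apply/row_span_sub => z; rewrite /irow => ez.
    have [->|nzb] := eqVneq z b; first exact: addsmxSl.
    rewrite U'E //; have [zab|nzab] := boolP (a < z < b)%N.
      by rewrite (between_loop zab).1 sub0mx.
    apply: submx_trans (addsmxSr _ _); apply: mem_row_span; rewrite /irow.
    by move: nzb nzab; rewrite -!val_eqE /=; lia.
  rewrite -(@row_spanE (irow b.+1 x)); last by rewrite /irow; lia.
  by apply: sub_row_span => z; rewrite /irow; lia.
have [->|nxy] := eqVneq x y; first by rewrite g'Vy gVy ltnn; lia.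
rewrite g'V //; have := gVbtw nxi nxy; lia.
Qed.

Lemma necklace_inv_bridge : necklace_inv i.+1 U' g'.
Proof.
have le_ia := le_ia; split; [exact: bridge_col|exact: bridge_row|..] => x.
- move=> mx; have nxi : x != i by apply: contraTneq mx => ->; rewrite -ltnNge.
  have := inv_le inv mx; have [->|nxy] := eqVneq x y; last by rewrite g'V.
  by rewrite g'Vy gVy; lia.
- move=> xm; have := inv_ge inv xm.
  have [->|nxi] := eqVneq x i; first by rewrite g'Vi; lia.
  have [xy|nxy] := eqVneq x y; last by rewrite g'V.
  by move: xm; rewrite xy g'Vy => /y_row; lia.
- move=> xm; have [Ux gx] := inv_loop inv xm.
  have nxb : x != b by rewrite -val_eqE /=; lia.
  have nxi : x != i by rewrite -val_eqE /=; lia.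
  have nxy : x != y by rewrite -{1}gx (inj_eq perm_inj).
  by rewrite U'E // /g' permM gx tpermD // eq_sym.
Qed.

End Bridge.

(** The vector [U' i] is the only one with a nonzero coordinate [k], so it takes part in no relation
    and all thresholds stay the same. *)
Lemma necklace_inv_activate U U' g (i : 'I_d) (k : 'I_m) :
    necklace_inv i U g -> (i < m)%N -> (forall z, U z 0 k = 0) ->
    U' i 0 k != 0 -> (forall z, z != i -> U' z = U z) ->
  necklace_inv i.+1 U' g.
Proof.
move=> inv im Uk U'k U'E; have [Ui gi] : U i = 0 /\ g i = i.
  by apply: (inv_loop inv); rewrite leqnn.
have gVi : (g^-1)%g i = i by rewrite -{1}gi permK.
have subE P (x : 'rV_m) : x 0 k = 0 -> (x <= row_span U' P)%MS = (x <= row_span U P)%MS.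
  move=> xk; apply/idP/idP => [xP|/submx_trans -> //].
    apply: (@coord_sub_row_span _ _ k (U' i)) => //.
    apply: submx_trans xP _; apply/row_span_sub => z Pz.
    have [->|/U'E ->] := eqVneq z i; first exact: addsmxSl.
    exact: submx_trans (mem_row_span _ Pz) (addsmxSr _ _).
  apply/row_span_sub => z Pz; have [->|/U'E <-] := eqVneq z i; last exact: mem_row_span.
  by rewrite Ui sub0mx.
split=> [x s mx sx|x s|x|x|x /andP [ix xm]].
- by rewrite U'E ?subE ?(inv_col inv) // -val_eqE /=; lia.
- rewrite ltnS leq_eqVlt => /orP [/eqP/val_inj-> ilts|xi xs].
    rewrite gVi [RHS]leqNgt ilts; apply/negbTE/negP => iP.
    have Z : (row_span U' (irow s i) <= kermx (delta_mx k 0 : 'cV[F]_m))%MS.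
      apply/row_span_sub => z; rewrite /irow => iz.
      rewrite U'E; last by rewrite -val_eqE /=; lia.
      by apply/sub_kermxP/matrixP => i' j'; rewrite -colE !mxE !ord1.
    have /sub_kermxP/matrixP/(_ 0 0) := submx_trans iP Z; rewrite -colE !mxE => U0.
    by rewrite U0 eqxx in U'k.
  by rewrite U'E ?subE ?(inv_row inv) // -val_eqE /=; lia.
- exact: (inv_le inv).
- exact: (inv_ge inv).
- have [Ux gx] : U x = 0 /\ g x = x.
    by apply: (inv_loop inv); rewrite xm andbT ltnW.
  by split=> //; rewrite U'E // -val_eqE /=; lia.
Qed.

End Spans.

(** * Greedy bases *)

Section Gale.
Variables (d : nat) (key : 'I_d -> nat).
Hypothesis key_inj : injective key.
Implicit Types (I J : {set 'I_d}) (s t : seq 'I_d).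

Definition key_le : rel 'I_d := fun x y => (key x <= key y)%N.

Definition below p I := [set x in I | (key x < p)%N].

Lemma in_below p I x : (x \in below p I) = (x \in I) && (key x < p)%N.
Proof. by rewrite inE. Qed.

Lemma card_below p I s : perm_eq s (enum I) ->
  #|below p I| = count (fun x => (key x < p)%N) s.
Proof.
move=> /seq.permP ->; rewrite -sum1_card -sum1_count big_enum_cond /=.
by apply: eq_bigl => x; rewrite inE.
Qed.

(** If the element of index [r], from 0, of [I] came after that of [J], then up to the key of the
    latter [J] would have at least [r + 1] elements and [I] at most [r]. *)
Lemma dominance_all2 I J : #|I| = #|J| ->
    (forall p, (#|below p J| <= #|below p I|)%N) ->
  all2 key_le (sort key_le (enum I)) (sort key_le (enum J)).
Proof.
move=> eqIJ dom; set s := sort _ _; set t := sort _ (enum J).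
have le_tr : transitive key_le by move=> x y z; apply: leq_trans.
have le_tot : total key_le by move=> x y; apply: leq_total.
have sz_s : size s = #|I| by rewrite size_sort -cardE.
have sz_t : size t = #|J| by rewrite size_sort -cardE.
have s_sorted : sorted key_le s by apply: sort_sorted.
have t_sorted : sorted key_le t by apply: sort_sorted.
rewrite all2E sz_s sz_t eqIJ eqxx /=.
case E: s => [|x0 s']; [by case: (t)|rewrite -E {E s'}].
apply/(all_nthP (x0, x0)) => r; rewrite size_zip sz_s sz_t eqIJ minnn => rJ.
rewrite nth_zip ?sz_s ?sz_t //= /key_le leqNgt; apply/negP => ts.
set p := (key (nth x0 t r)).+1.
have := dom p; rewrite (@card_below p J t) ?perm_sort // (@card_below p I s) ?perm_sort //.
rewrite leqNgt => /negP []; apply: (@leq_ltn_trans r).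
  rewrite -(cat_take_drop r s) count_cat -[leqRHS]addn0 leq_add //.
    by apply: leq_trans (count_size _ _) _; rewrite size_take; case: ltnP.
  rewrite leqn0 -(negbK (_ == _)) -lt0n -has_count; apply/negP => /hasP [z].
  move=> /(nthP x0) [k]; rewrite size_drop => ks; rewrite nth_drop => <-.
  rewrite ltnS leqNgt => /negP []; apply: leq_trans ts _.
  apply: (sorted_leq_nth le_tr _ x0 s_sorted); rewrite ?inE ?leq_addr //.
  - by move=> x; apply: leqnn.
  - by rewrite sz_s eqIJ.
  - by rewrite -ltn_subRL.
rewrite -(cat_take_drop r.+1 t) count_cat; apply: ltn_addr.
have : all (fun x => (key x < p)%N) (take r.+1 t).
  apply/(all_nthP x0) => k; rewrite size_take sz_t => kr.
  have kr' : (k < r.+1)%N by move: kr; case: ifP; lia.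
  rewrite nth_take // ltnS.
  apply: (sorted_leq_nth le_tr _ x0 t_sorted); rewrite ?inE //.
  - by move=> x; apply: leqnn.
  - by rewrite sz_t; lia.
  - by rewrite sz_t.
by rewrite all_count => /eqP ->; rewrite size_take sz_t; case: ifP; lia.
Qed.

Lemma all2_key_anti s t : all2 key_le s t -> all2 key_le t s -> s = t.
Proof.
elim: s t => [|x s IH] [|y t] //= /andP [xy st] /andP [yx ts].
by rewrite (IH t) // (key_inj (anti_leq (introT andP (conj xy yx)))).
Qed.

End Gale.

Section Greedy.
Variables (F : fieldType) (m d : nat) (W : 'I_d -> 'rV[F]_m) (key : 'I_d -> nat).
Hypothesis key_inj : injective key.

Definition spanning (I : {set 'I_d}) : bool := \rank (row_span W [in I]) == m.

Definition greedy : {set 'I_d} :=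
  [set x | ~~ (W x <= row_span W (fun y => (key y < key x)%N))%MS].

Lemma rank_row_span_le (P : pred 'I_d) : (\rank (row_span W P) <= #|P|)%N.
Proof.
rewrite -sum1_card /row_span; elim/big_ind2: _ => [|A k B l Ak Bl|x _].
- by rewrite mxrank0.
- by apply: leq_trans (mxrank_adds_leqif A B).1 _; apply: leq_add.
- by rewrite genmxE rank_leq_row.
Qed.

Lemma rank_addv (v : 'rV[F]_m) (A : 'M_m) :
  \rank (v + A)%MS = (~~ (v <= A)%MS + \rank A)%N.
Proof.
have [vA|nvA] := boolP (v <= A)%MS; first by rewrite (addsmx_idPr vA).
rewrite mxrank_disjoint_sum.
  by rewrite rank_rV; congr (nat_of_bool _ + _)%N; apply: contraNneq nvA => ->; rewrite sub0mx.
apply/eqP; rewrite -mxrank_eq0 -leqn0 leqNgt; apply/negP => r0; case/negP: nvA.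
apply: submx_trans (capmxSr v A); case: (mxrank_leqif_sup (capmxSl v A)) => _ <-.
by rewrite eqn_leq mxrankS ?capmxSl // (leq_trans (rank_leq_row v)).
Qed.

(** By induction on [p]: the label of key [p], if any, is greedy exactly when its vector raises the
    rank. *)
Lemma greedy_below p :
  (row_span W (fun x => (key x < p)%N) <= row_span W [in below key p greedy])%MS /\
  \rank (row_span W (fun x => (key x < p)%N)) = #|below key p greedy|.
Proof.
elim: p => [|p [IHs IHr]].
  split; first by apply/row_span_sub => z; rewrite ltn0.
  rewrite /row_span big_pred0 // mxrank0; apply/esym/eqP; rewrite cards_eq0.
  by apply/eqP/setP => x; rewrite !inE andbF.
case: (pickP (fun x => key x == p)) => [x /eqP xp|noP]; last first.
  have kp z : (key z < p.+1)%N = (key z < p)%N.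
    by rewrite ltnS leq_eqVlt noP.
  have -> : below key p.+1 greedy = below key p greedy.
    by apply/setP => z; rewrite !inE kp.
  by rewrite (eq_row_span (U := W) (U' := W) kp).
have kp z : (key z < p.+1)%N = (z == x) || (key z < p)%N.
  by rewrite ltnS leq_eqVlt -xp (inj_eq key_inj).
have row_spanE : (row_span W (fun z => (key z < p.+1)%N) :=:
            W x + row_span W (fun z => (key z < p)%N))%MS.
  apply/eqmxP/andP; split.
    apply/row_span_sub => z; rewrite kp => /predU1P [->|zp]; first exact: addsmxSl.
    by apply: submx_trans (addsmxSr _ _); apply: mem_row_span.
  rewrite addsmx_sub mem_row_span /=; last by rewrite xp.
  by apply: row_span_subset => z zp; apply: leqW.
have Gx : (x \in greedy) = ~~ (W x <= row_span W (fun z => (key z < p)%N))%MS.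
  by rewrite inE xp.
have belowE : below key p.+1 greedy =
    if x \in greedy then x |: below key p greedy else below key p greedy.
  apply/setP => z; rewrite in_below kp; case: (boolP (x \in greedy)) => xG.
    by rewrite in_setU1 in_below; case: eqVneq => [->|] //=; rewrite xG.
  rewrite in_below; case: eqVneq => [->|] //=.
  by rewrite (negPf xG).
split.
  rewrite row_spanE addsmx_sub belowE; apply/andP; split; last first.
    apply: submx_trans IHs _; apply: row_span_subset => z; case: ifP => // _.
    by rewrite /= in_setU1 => ->; rewrite orbT.
  case: ifP => [_|]; first by apply: mem_row_span; rewrite /= setU11.
  by rewrite Gx => /negbFE xs; apply: submx_trans xs IHs.
rewrite row_spanE rank_addv -Gx IHr belowE; case: ifP => _ //.
by rewrite cardsU1 in_below xp ltnn andbF.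
Qed.

(** The labels of [J] outside the segment add at most their number to the rank, so those inside must
    reach theirs; this is bounded by the rank of the whole segment, which [greedy_below]
    computes. *)
Lemma spanning_below p (J : {set 'I_d}) : #|J| = m -> spanning J ->
  (#|below key p J| <= #|below key p greedy|)%N.
Proof.
move=> cJ /eqP sJ; rewrite -(greedy_below p).2.
pose K := J :\: below key p J.
have : (row_span W [in J] <= row_span W [in below key p J] + row_span W [in K])%MS.
  apply/row_span_sub => z zJ; have [zb|zb] := boolP (z \in below key p J).
    by apply: submx_trans (addsmxSl _ _); apply: mem_row_span.
  by apply: submx_trans (addsmxSr _ _); apply: mem_row_span; rewrite /= in_setD zb.
move/mxrankS; rewrite sJ => /leq_trans /(_ (mxrank_adds_leqif _ _).1) mr.
have : (\rank (row_span W [in below key p J]) <=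
        \rank (row_span W (fun x => (key x < p)%N)))%N.
  by apply/mxrankS/row_span_subset => z; rewrite /= inE => /andP [].
have := rank_row_span_le [in K].
have : below key p J \subset J by apply/subsetP => z; rewrite inE => /andP [].
move=> /setIidPr IJ; have -> : #|[in K]| = (m - #|below key p J|)%N.
  have := cardsD J (below key p J); rewrite IJ -cJ => <-; by apply: eq_card.
have := subset_leq_card (subsetIr J (below key p J)); rewrite IJ.
have : (#|below key p J| <= m)%N.
  by rewrite -cJ -IJ subset_leq_card ?subsetIl.
rewrite (eq_card (B := below key p J)) //; lia.
Qed.

Lemma greedy_spanning (J : {set 'I_d}) : #|J| = m -> spanning J ->
  #|greedy| = m /\ spanning greedy.
Proof.
move=> cJ /eqP sJ; pose p := (\max_x key x).+1.
have kp x : (key x < p)%N by rewrite ltnS; apply: leq_bigmax.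
have bE : below key p greedy = greedy by apply/setP => x; rewrite in_below kp andbT.
have [] := greedy_below p; rewrite bE => Gs Gr.
have full : \rank (row_span W (fun x => (key x < p)%N)) = m.
  apply/eqP; rewrite eqn_leq rank_leq_row -{1}sJ mxrankS //.
  by apply: row_span_subset => x.
split; first by rewrite -Gr full.
by rewrite /spanning eqn_leq rank_leq_row -{1}full mxrankS.
Qed.

End Greedy.

(** * The Cauchon graph *)

Section CauchonGraph.
Variables (m n : nat) (C : {set 'I_m * 'I_n}).

Local Notation V := (vertex m n).

(** * Predecessors in the Cauchon graph *)

Definition is_right_neighbor (i : 'I_m) (j : nat) : pred 'I_n := fun l =>
  [&& (j <= l)%N, (i, l) \notin C & [forall l' : 'I_n, (j <= l' < l)%N ==> ((i, l') \in C)]].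

(** The search includes column [j], while [upper_neighbor i j] stays strictly above row [i]; a white
    square [(i, j)] thus has the predecessors [right_neighbor i j.+1] and [upper_neighbor i j]. *)
Definition right_neighbor (i : 'I_m) (j : nat) : V :=
  if [pick l | is_right_neighbor i j l] is Some l then Square i l else Source n i.

Definition is_upper_neighbor (i : nat) (j : 'I_n) : pred 'I_m := fun k =>
  [&& (k < i)%N, (k, j) \notin C & [forall k' : 'I_m, (k < k' < i)%N ==> ((k', j) \in C)]].

Definition upper_neighbor (i : nat) (j : 'I_n) : option V :=
  omap (fun k => Square k j) [pick k | is_upper_neighbor i j k].

Lemma is_right_neighborS i (j : 'I_n) l : is_right_neighbor i j l =
  if (i, j) \in C then is_right_neighbor i j.+1 l else l == j.
Proof.
rewrite /is_right_neighbor; case: ifP => [ijC|/negbT ijC].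
  apply/and3P/and3P => [[jl lC /forallP lP]|[jl lC /forallP lP]]; split=> //.
  - by rewrite ltn_neqAle jl andbT; apply: contraNneq lC => /val_inj <-.
  - by apply/forallP => l'; apply/implyP => jl'; apply: (implyP (lP l')); lia.
  - exact: ltnW.
  - apply/forallP => l'; apply/implyP => /andP [jl' l'l].
    have [/val_inj <- //|] := eqVneq (j : nat) l'.
    by move=> njl; apply: (implyP (lP l')); rewrite l'l andbT ltn_neqAle njl.
apply/and3P/eqP => [[jl lC /forallP lP]|->].
  apply/eqP; apply: contraNT ijC => nlj; apply: (implyP (lP j)).
  by rewrite leqnn /= ltn_neqAle jl andbT eq_sym.
by split=> //; apply/forallP => l'; apply/implyP; lia.
Qed.

Lemma right_neighborS i (j : 'I_n) : right_neighbor i j =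
  if (i, j) \in C then right_neighbor i j.+1 else Square i j.
Proof.
rewrite /right_neighbor; case: ifP => ijC.
  by rewrite (eq_pick (is_right_neighborS i j)) ijC.
rewrite (eq_pick (is_right_neighborS i j)) ijC.
by case: pickP => [l /eqP -> //|/(_ j)]; rewrite eqxx.
Qed.

Lemma right_neighbor_last i : right_neighbor i n = Source n i.
Proof.
rewrite /right_neighbor; case: pickP => [l /and3P []|//].
by rewrite leqNgt ltn_ord.
Qed.

Lemma is_upper_neighborS (i : 'I_m) j k : is_upper_neighbor i.+1 j k =
  if (i, j) \in C then is_upper_neighbor i j k else k == i.
Proof.
rewrite /is_upper_neighbor; case: ifP => [ijC|/negbT ijC].
  apply/and3P/and3P => [[ki kC /forallP kP]|[ki kC /forallP kP]]; split=> //.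
  - by rewrite ltn_neqAle -ltnS ki andbT; apply: contraNneq kC => /val_inj ->.
  - by apply/forallP => k'; apply/implyP => kk'; apply: (implyP (kP k')); lia.
  - by apply: leqW.
  - apply/forallP => k'; apply/implyP => /andP [kk' k'i].
    have [/val_inj -> //|] := eqVneq (k' : nat) i.
    by move=> nki; apply: (implyP (kP k')); rewrite kk' ltn_neqAle nki -ltnS.
apply/and3P/eqP => [[ki kC /forallP kP]|->].
  apply/eqP; apply: contraNT ijC => nki; apply: (implyP (kP i)).
  by rewrite leqnn andbT ltn_neqAle -ltnS ki andbT.
by split=> //; apply/forallP => k'; apply/implyP; lia.
Qed.

Lemma upper_neighborS (i : 'I_m) j : upper_neighbor i.+1 j =
  if (i, j) \in C then upper_neighbor i j else Some (Square i j).
Proof.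
rewrite /upper_neighbor (eq_pick (is_upper_neighborS i j)); case: ifP => ijC //.
by case: pickP => [l /eqP -> //|/(_ i)]; rewrite eqxx.
Qed.

Lemma upper_neighbor0 j : upper_neighbor 0 j = None.
Proof. by rewrite /upper_neighbor; case: pickP => // l /and3P []. Qed.

Lemma upper_neighbor_black (i : 'I_m) j :
  (forall k : 'I_m, (k < i)%N -> (k, j) \in C) -> upper_neighbor i j = None.
Proof.
move=> kC; rewrite /upper_neighbor; case: pickP => // k /and3P [ki].
by rewrite kC.
Qed.

Lemma is_right_neighbor_uniq i j l l' :
  is_right_neighbor i j l -> is_right_neighbor i j l' -> l = l'.
Proof.
move=> /and3P [jl lC /forallP lP] /and3P [jl' lC' /forallP lP'].
apply: val_inj; have [ll|ll|//] := ltngtP l l'.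
  by case/negP: lC; apply: (implyP (lP' l)); rewrite jl.
by case/negP: lC'; apply: (implyP (lP l')); rewrite jl'.
Qed.

Lemma is_upper_neighbor_uniq i j k k' :
  is_upper_neighbor i j k -> is_upper_neighbor i j k' -> k = k'.
Proof.
move=> /and3P [ki kC /forallP kP] /and3P [ki' kC' /forallP kP'].
apply: val_inj; have [kk|kk|//] := ltngtP k k'.
  by case/negP: kC'; apply: (implyP (kP k')); rewrite kk.
by case/negP: kC; apply: (implyP (kP' k)); rewrite kk.
Qed.

Lemma eq_right_square i j i' l :
  (Square i' l == right_neighbor i j) = (i' == i) && is_right_neighbor i j l.
Proof.
rewrite /right_neighbor; case: pickP => [l' lP|->]; last by rewrite andbF.
apply/eqP/andP => [[-> ->]|[/eqP -> lP']]; first by rewrite eqxx.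
by rewrite (is_right_neighbor_uniq lP lP').
Qed.

Lemma eq_right_source i j i' : (Source n i' == right_neighbor i j) =
  (i' == i) && [forall l : 'I_n, (j <= l)%N ==> ((i, l) \in C)].
Proof.
rewrite /right_neighbor; case: pickP => [l /and3P [jl lC _]|noP].
  apply/esym/negbTE; rewrite negb_and; apply/orP; right.
  by apply/forallPn; exists l; rewrite jl.
rewrite [RHS](_ : _ = (i' == i)); last first.
  rewrite andbC; case: forallP => // jC; case: jC => l; apply/implyP => jl.
  apply/negPn/negP => lC.
  have Pl : (j <= l)%N && ((i, l) \notin C) by rewrite jl.
  case: (@arg_minnP _ l (fun l => (j <= l)%N && ((i, l) \notin C)) val Pl).
  move=> l' /andP [jl' l'C] l'min; have := noP l'; rewrite /is_right_neighbor jl' l'C /=.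
  case/forallP => k; apply/implyP => /andP [jk kl']; apply/negPn/negP => kC.
  by have := l'min k; rewrite jk kC /= leqNgt kl' => /(_ isT).
by apply/eqP/eqP => [[]|->].
Qed.

Lemma eq_upper_square i j k j' :
  (Some (Square k j') == upper_neighbor i j) = (j' == j) && is_upper_neighbor i j k.
Proof.
rewrite /upper_neighbor; case: pickP => [k' kP|->]; last by rewrite andbF.
apply/eqP/andP => [[-> ->]|[/eqP -> kP']]; first by rewrite eqxx.
by rewrite (is_upper_neighbor_uniq kP kP').
Qed.

Lemma eq_upper_inl i j p : (Some (inl p) == upper_neighbor i j) = false.
Proof. by rewrite /upper_neighbor; case: pickP. Qed.

Lemma edge_square p i j : (i, j) \notin C -> edge C p (Square i j) =
  (p == right_neighbor i j.+1) || (Some p == upper_neighbor i j).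
Proof.
move=> ijC; case: p => [[i'|l]|[i' j']]; rewrite ?eq_upper_inl ?orbF.
- rewrite -[inl (inl i')]/(Source n i') eq_right_source /=.
  by case: eqVneq => //= ->; rewrite ijC.
- by rewrite /right_neighbor; case: pickP.
- rewrite -[inr _]/(Square i' j') eq_right_square eq_upper_square /= ijC.
  rewrite /is_right_neighbor /is_upper_neighbor.
  case: (eqVneq i' i) => [->|_]; case: (eqVneq j' j) => [->|_] //=.
  + by rewrite ijC !ltnn.
  + by rewrite !orbF andbCA.
  + by rewrite andbCA.
  + by rewrite andbF.
Qed.

Lemma edge_sink p j : edge C p (Sink m j) = (Some p == upper_neighbor m j).
Proof.
case: p => [[i'|l]|[i' j']] //; rewrite ?eq_upper_inl //.
rewrite -[inr _]/(Square i' j') eq_upper_square /= /is_upper_neighbor ltn_ord /=.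
case: (eqVneq j' j) => //= ->; congr (_ && _); apply: eq_forallb => k.
by rewrite ltn_ord andbT.
Qed.

Lemma edge_source p i : edge C p (Source n i) = false.
Proof. by case: p => [[i'|l]|[i' j']]. Qed.

(** [i + (n - j)] increases both leftwards and downwards, and lies strictly between the values of
    sources and sinks. *)
Definition height (p : V) : nat :=
  match p with
  | inl (inl _) => 0
  | inl (inr _) => m + n + 1
  | inr (i, j) => i + (n - j)
  end.

Lemma edge_height p p' : edge C p p' -> (height p < height p')%N.
Proof.
case: p => [[i|j]|[i j]]; case: p' => [[i'|j']|[i' j']] //=.
- by have := ltn_ord j'; lia.
- by have := ltn_ord i; have := ltn_ord j; lia.
- case/and3P => _ _ /orP [/and3P [/eqP -> jj _]|/and3P [/eqP -> ii _]] //.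
    by have := ltn_ord j; lia.
  by rewrite ltn_add2r.
Qed.

(** * Vectors carried by rows and columns during the whitening *)

Section Weights.
Variables (F : fieldType) (u : V -> 'rV[F]_m) (t : V -> V -> F).
Hypotheses (t_neq0 : forall x y, t x y != 0)
  (uE : forall w, u w = \sum_(k | Source n k == w) delta_mx 0 k
                        + \sum_(p | edge C p w) t p w *: u p).

Definition column_vec i j : 'rV[F]_m := oapp u 0 (upper_neighbor i j).

Lemma u_source i : u (Source n i) = delta_mx 0 i.
Proof.
rewrite uE [X in _ + X]big_pred0 => [|p]; last exact: edge_source.
by rewrite addr0 (eq_bigl (pred1 i)) ?big_pred1_eq.
Qed.

Lemma u_square (i : 'I_m) j : (i, j) \notin C -> exists t1 t2,
  [/\ t1 != 0, t2 != 0
    & u (Square i j) = t1 *: column_vec i j + t2 *: u (right_neighbor i j.+1)].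
Proof.
move=> ijC; rewrite uE [X in X + _]big_pred0 ?add0r; last by move=> k; apply/eqP.
rewrite (eq_bigl _ _ (fun p => edge_square p ijC)) /column_vec.
case E: (upper_neighbor i j) => [p0|] /=; last first.
  exists 1, (t (right_neighbor i j.+1) (Square i j)); split=> //.
    exact: oner_neq0.
  by rewrite scaler0 add0r (eq_bigl _ _ (fun p => orbF _)) big_pred1_eq.
have np : right_neighbor i j.+1 != p0.
  rewrite -(inj_eq Some_inj) -E; apply: contraT => /negPn.
  rewrite /right_neighbor; case: pickP => [l|_]; last by rewrite eq_upper_inl.
  rewrite eq_upper_square => lP /andP [/eqP lj].
  by move: lP; rewrite lj /is_right_neighbor ltnn.
exists (t p0 (Square i j)), (t (right_neighbor i j.+1) (Square i j)); split=> //.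
rewrite (bigD1 (right_neighbor i j.+1)) ?eqxx //= addrC; congr (_ + _).
rewrite (eq_bigl (pred1 p0)) ?big_pred1_eq // => p.
rewrite (inj_eq Some_inj) /=; case: (eqVneq p p0) => [->|_].
  by rewrite orbT eq_sym np.
by rewrite orbF andbN.
Qed.

Lemma u_sink j : exists2 t1, t1 != 0 & u (Sink m j) = t1 *: column_vec m j.
Proof.
rewrite uE [X in X + _]big_pred0 ?add0r; last by move=> k; apply/eqP.
rewrite (eq_bigl _ _ (fun p => edge_sink p j)) /column_vec.
case: (upper_neighbor m j) => [p0|] /=; last first.
  by exists 1; rewrite ?oner_neq0 // scaler0 big_pred0.
by exists (t p0 (Sink m j)) => //; rewrite (eq_bigl (pred1 p0)) ?big_pred1_eq.
Qed.

Lemma column_vecS (i : 'I_m) j : column_vec i.+1 j =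
  if (i, j) \in C then column_vec i j else u (Square i j).
Proof. by rewrite /column_vec upper_neighborS; case: ifP. Qed.

(** The source of row [i] carries the [i]-th basis vector; going left, each white square takes a
    nonzero multiple of the vector to its right plus a column vector that vanishes from coordinate
    [i] on. *)
Lemma right_coord (i : 'I_m) j : (j <= n)%N ->
    (forall l (k : 'I_m), (i <= k)%N -> column_vec i l 0 k = 0) ->
  u (right_neighbor i j) 0 i != 0 /\
  forall k : 'I_m, (i < k)%N -> u (right_neighbor i j) 0 k = 0.
Proof.
move=> + colz; have [N] := ubnP (n - j)%N; elim: N j => // N IH j nj jn.
have [ltjn|lenj] := ltnP j n; last first.
  have -> : j = n by apply/anti_leq; rewrite jn.
  rewrite right_neighbor_last u_source mxE !eqxx oner_neq0; split=> // k ik.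
  by rewrite mxE eqxx /=; case: eqP => // ki; rewrite ki ltnn in ik.
have [|//|Hi Hk] := IH j.+1; first by lia.
rewrite (right_neighborS i (Ordinal ltjn)); case: ifP => // /negbT ijC.
have [t1 [t2 [_ t20 ->]]] := u_square ijC; split=> [|k ik].
  by rewrite !mxE colz // mulr0 add0r mulf_neq0.
by rewrite !mxE colz ?Hk ?mulr0 ?addr0 // ltnW.
Qed.

(** Squares above row [i] are reached only from sources above row [i]. *)
Lemma column_coord i j (k : 'I_m) : (i <= m)%N -> (i <= k)%N -> column_vec i j 0 k = 0.
Proof.
elim: i j k => [|i IH] j k im ik; first by rewrite /column_vec upper_neighbor0 mxE.
rewrite (column_vecS (Ordinal im)); case: ifP => [_|/negbT ijC].
  by rewrite IH // ltnW.
have colz l (k' : 'I_m) : (Ordinal im <= k')%N -> column_vec (Ordinal im) l 0 k' = 0.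
  by move=> /= ik'; rewrite IH // ltnW.
have [t1 [t2 [_ _ ->]]] := u_square ijC.
have [_ Hk] := right_coord (ltn_ord j) colz.
by rewrite !mxE colz ?Hk ?mulr0 ?addr0 //; apply: ltnW.
Qed.

Hypothesis C_cauchon : cauchon C.
Variable omega : 'S_(m + n).
Hypothesis omegaE : forall x : 'I_(m + n),
  omega x = (if (x < m)%N then m - x.+1 else 2 * m + n - x.+1)%N :> nat.

Definition col_label (j : 'I_n) : 'I_(m + n) := rshift m (rev_ord j).

Lemma labelP (x : 'I_(m + n)) : (exists i, x = lshift n i) \/ exists j, x = col_label j.
Proof.
case: (splitP x) => [i xi|l xl]; [left; exists i|right; exists (rev_ord l)].
  exact: val_inj.
by apply: val_inj; rewrite /col_label rev_ordK.
Qed.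

Definition vertex_label (p : V) : 'I_(m + n) :=
  match p with
  | inl (inl i) => lshift n i
  | inl (inr j) => col_label j
  | inr (i, j) => col_label j
  end.

Definition black i j := [exists b in C, (b.1 == i :> nat) && (b.2 == j :> nat)].

Lemma blackE (i : 'I_m) (j : 'I_n) : black i j = ((i, j) \in C).
Proof.
apply/existsP/idP => [[[i' j'] /and3P [ijC /eqP/val_inj <- /eqP/val_inj <-]] //|ijC].
by exists (i, j); rewrite ijC !eqxx.
Qed.

(** The vectors matching [stage_black]. The bound [r] on active sources is separate from [i] because
    the source of row [i] is activated before any square of that row is treated. *)
Definition stage_vec r i j (x : 'I_(m + n)) : 'rV[F]_m :=
  match split x with
  | inl k => if (k < r)%N then delta_mx 0 k else 0
  | inr l => if (j <= rev_ord l)%N then column_vec i.+1 (rev_ord l)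
             else column_vec i (rev_ord l)
  end.

Lemma stage_vec_row r i j k :
  stage_vec r i j (lshift n k) = if (k < r)%N then delta_mx 0 k else 0.
Proof. by rewrite /stage_vec (unsplitK (inl _ k)). Qed.

Lemma stage_vec_col r i j l : stage_vec r i j (col_label l) =
  if (j <= l)%N then column_vec i.+1 l else column_vec i l.
Proof. by rewrite /stage_vec (unsplitK (inr _ _)) rev_ordK. Qed.

Lemma stage_vec_step r (i : 'I_m) (j : 'I_n) (x : 'I_(m + n)) : x != col_label j ->
  stage_vec r i j x = stage_vec r i j.+1 x.
Proof.
case: (labelP x) => [[k ->]|[l ->]]; first by rewrite !stage_vec_row.
rewrite (inj_eq (@rshift_inj _ _)) (inj_eq rev_ord_inj) -val_eqE /= => lj.
by rewrite !stage_vec_col [(j <= l)%N]leq_eqVlt eq_sym (negPf lj).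
Qed.

(** Descending induction on [j]. The second conclusion supplies the hypothesis [g a = i] of the
    bridge, where [a] is the label of the right neighbor. *)
Lemma row_stages (i : 'I_m) j : (j <= n)%N ->
    necklace_inv i (stage_vec i i n) (pipe omega (stage_black black i n)) ->
  necklace_inv i.+1 (stage_vec i.+1 i j) (pipe omega (stage_black black i j)) /\
  pipe omega (stage_black black i j) (vertex_label (right_neighbor i j)) = lshift n i.
Proof.
move=> + inv0; have [N] := ubnP (n - j)%N; elim: N j => // N IH j nj jn.
have colz l (k : 'I_m) : (i <= k)%N -> column_vec i l 0 k = 0.
  by apply: column_coord; apply: ltnW.
have [ltjn|lenj] := ltnP j n; last first.
  have -> : j = n by apply/anti_leq; rewrite jn.
  split.
    apply: (@necklace_inv_activate _ _ _ (stage_vec i i n) _ _ (lshift n i) i) => //= [z||z].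
    - case: (labelP z) => [[k ->]|[l ->]].
        rewrite stage_vec_row; case: ltnP => ki; rewrite !mxE // andbC.
        by case: eqP => // ik; rewrite ik ltnn in ki.
      by rewrite stage_vec_col leqNgt ltn_ord colz.
    - by rewrite stage_vec_row ltnSn !mxE !eqxx oner_neq0.
    - case: (labelP z) => [[k ->]|[l ->] _]; last by rewrite !stage_vec_col.
      rewrite (inj_eq (@lshift_inj _ _)) -val_eqE /= => nki.
      by rewrite !stage_vec_row ltnS leq_eqVlt (negPf nki).
  rewrite right_neighbor_last /=.
  by case: (inv_loop inv0 (x := lshift n i)) => //=; rewrite leqnn /=.
have [||inv1 pipe1] := IH j.+1; [by lia|by []|].
pose jo := Ordinal ltjn; rewrite (right_neighborS i jo); case: ifP => ijC.
  have -> : stage_vec i.+1 i j = stage_vec i.+1 i j.+1.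
    apply: funext => x; have [->|xj] := eqVneq x (col_label jo); last first.
      exact: (stage_vec_step _ _ xj).
    by rewrite !stage_vec_col leqnn ltnn column_vecS ijC.
  have -> : stage_black black i j = stage_black black i j.+1; last by [].
  apply: funext => i'; apply: funext => j'; rewrite /stage_black ltnS.
  rewrite [(j' <= j)%N]leq_eqVlt; case: (eqVneq i' i) => //= -> //.
  case: (eqVneq j' j) => //= ->.
  by rewrite (blackE i jo) ijC.
have ijC' : (i, jo) \notin C by rewrite ijC.
have stepE := pipe_step omegaE (ltn_ord i) ltjn (_ : ~~ black i j)
  (x := lshift n i) (y := col_label jo) erefl _.
rewrite {}stepE; [|by rewrite (blackE i jo) ijC|by rewrite /=; lia].
set g := pipe omega _ in inv1 pipe1 *; split; last first.
  by rewrite permM /= tpermR.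
have [t1 [t2 [t10 t20 uij]]] := u_square ijC'.
set p := right_neighbor i j.+1 in pipe1 uij.
have aU : stage_vec i.+1 i j.+1 (vertex_label p) = u p.
  rewrite /p /right_neighbor; case: pickP => [l /and3P [jl lC _]|_] /=.
    by rewrite stage_vec_col jl column_vecS (negPf lC).
  by rewrite stage_vec_row ltnSn u_source.
apply: (@necklace_inv_bridge _ _ _ (stage_vec i.+1 i j.+1) _ g (lshift n i) (vertex_label p)
  (col_label jo) i t1 t2) => //=.
- exact: leq_addr.
- rewrite /p /right_neighbor; case: pickP => [l /and3P [jl lC _]|_] /=.
    by have := ltn_ord l; lia.
  by have := ltn_ord i; lia.
- rewrite /p /right_neighbor; case: pickP => [l _|_] /=; last by left.
  by right; apply: leq_addr.
- move=> z; case: (labelP z) => [[k ->] _|[l ->] /= /andP [pl lj] _].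
    by rewrite leqNgt /= ltn_ord.
  have ltjl : (j < l)%N by have := ltn_ord l; lia.
  have ilC : (i, l) \in C.
    have := eqxx p; rewrite {2}/p; case: (p) pl => [[i'|j']|[i' l']] /= pl.
    - rewrite -[inl (inl i')]/(Source n i') eq_right_source => /andP [_ /forallP jC].
      exact: (implyP (jC l)).
    - by rewrite /right_neighbor; case: pickP.
    - rewrite -[inr _]/(Square i' l') eq_right_square => /andP [_ /and3P [_ _ /forallP jC]].
      by apply: (implyP (jC l)); have := ltn_ord l; have := ltn_ord l'; lia.
  (* The Cauchon condition enters here: [(i, l)] is black with the white square [(i, j)] to its
     left, so no white square lies above it and its column carries zero. *)
  rewrite stage_vec_col ltjl column_vecS ilC /column_vec upper_neighbor_black //.
  move=> k ki; apply/negPn/negP => klC; apply: (C_cauchon ilC); split.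
    by exists jo.
  by exists k.
- rewrite aU; exact: (right_coord ltjn colz).1.
- move=> z; case: (labelP z) => [[k ->]|[l ->]] /= jl.
    by have := ltn_ord k; have := ltn_ord i; lia.
  rewrite stage_vec_col ifF ?colz //; apply/negbTE; rewrite -leqNgt.
  by have := ltn_ord l; lia.
- move=> z; case: (labelP z) => [[k ->]|[l ->]] /= ki.
    rewrite stage_vec_row; case: ifP => _; rewrite !mxE // andbC.
    by case: eqP => // ik; rewrite ik ltnn in ki.
  by have := ltn_ord i; lia.
- by rewrite aU !stage_vec_col leqnn ltnn column_vecS (negPf ijC').
- by move=> z zj; exact: (stage_vec_step _ _ zj).
Qed.

Lemma row_stage i : (i <= m)%N ->
  necklace_inv i (stage_vec i i n) (pipe omega (stage_black black i n)).
Proof.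
elim: i => [_|i IH im].
  rewrite pipe_all // => [|[|i] j _ jn]; rewrite /stage_black ?jn ?orbT //.
  have U0 x : stage_vec 0 0 n x = 0.
    case: (labelP x) => [[k ->]|[l ->]]; first by rewrite stage_vec_row.
    by rewrite stage_vec_col leqNgt ltn_ord /column_vec upper_neighbor0.
  split=> // x; rewrite ?invg1 ?perm1 //.
  by move=> s _ sx; rewrite U0 sub0mx sx.
have [inv _] := @row_stages (Ordinal im) 0%N isT (IH (ltnW im)).
have -> : stage_vec i.+1 i.+1 n = stage_vec i.+1 i 0.
  apply: funext => x; case: (labelP x) => [[k ->]|[l ->]].
    by rewrite !stage_vec_row.
  by rewrite !stage_vec_col leqNgt ltn_ord.
(* The two colourings agree inside the grid, which is all that [word] sees. *)
have -> : pipe omega (stage_black black i.+1 n) = pipe omega (stage_black black i 0) => //.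
rewrite /pipe; congr (_ * wordp _ _ _ * _)%g; apply: eq_word => i' j' i'm j'n.
by rewrite /stage_black ltn0 andbF orbF j'n andbT; congr orb; lia.
Qed.

Lemma final_stage v : v = restricted_perm C ->
  necklace_inv m (stage_vec m m n) (perm (@rev_ord_inj (m + n)%N) * v * omega)%g.
Proof.
move=> ->; rewrite (restricted_permE blackE).
have -> : word m n black = word m n (stage_black black m n).
  apply: eq_word => i j im jn; rewrite /stage_black.
  by rewrite ltnNge (ltnW im) /= ltn_eqF // orbF.
exact: row_stage.
Qed.

(** * Greedy bases of the boundary vectors *)

Definition boundary (x : 'I_(m + n)) : V :=
  match split x with inl k => Source n k | inr l => Sink m (rev_ord l) end.

Lemma boundary_row k : boundary (lshift n k) = Source n k.
Proof. by rewrite /boundary (unsplitK (inl _ k)). Qed.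

Lemma boundary_col l : boundary (col_label l) = Sink m l.
Proof. by rewrite /boundary (unsplitK (inr _ _)) rev_ordK. Qed.

Definition boundary_vec x : 'rV[F]_m := u (boundary x).

Lemma boundary_stage x : exists2 c, c != 0 & boundary_vec x = c *: stage_vec m m n x.
Proof.
rewrite /boundary_vec; case: (labelP x) => [[k ->]|[l ->]].
  rewrite boundary_row stage_vec_row ltn_ord u_source.
  by exists 1; rewrite ?oner_neq0 // scale1r.
rewrite boundary_col stage_vec_col leqNgt ltn_ord.
exact: u_sink.
Qed.

Lemma boundary_row_span x (P : pred 'I_(m + n)) :
  (boundary_vec x <= row_span boundary_vec P)%MS =
  (stage_vec m m n x <= row_span (stage_vec m m n) P)%MS.
Proof.
have eqv z : (boundary_vec z :=: stage_vec m m n z)%MS.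
  by have [c c0 ->] := boundary_stage z; apply: eqmx_scale.
have -> : row_span boundary_vec P = row_span (stage_vec m m n) P.
  by apply: eq_bigr => z _; apply: eq_genmx.
by rewrite eqv.
Qed.

(** Position in the cyclic order starting at the 0-based label [s], that is, [cyc_le] with index
    [s + 1]. *)
Definition cyc_key (s : nat) (x : 'I_(m + n)) := ((x + (m + n) - s) %% (m + n))%N.

Lemma cyc_keyE s x : (s < m + n)%N ->
  cyc_key s x = (if s <= x then x - s else x + (m + n) - s)%N.
Proof.
move=> sd; have xd := ltn_ord x; rewrite /cyc_key; case: leqP => sx.
  by rewrite addnC -addnBA // modnDl modn_small //; lia.
by rewrite modn_small //; lia.
Qed.

Lemma cyc_key_inj s : (s < m + n)%N -> injective (cyc_key s).
Proof.
move=> sd x y; have xd := ltn_ord x; have yd := ltn_ord y.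
by rewrite !cyc_keyE // => xy; apply: ord_inj; move: xy; do 2!case: ifP; lia.
Qed.

Lemma cyc_key_lt s x y : (s < m + n)%N -> (cyc_key s y < cyc_key s x)%N =
  if (s <= x)%N then icol s x y else irow s x y.
Proof.
move=> sd; have xd := ltn_ord x; have yd := ltn_ord y.
by rewrite !cyc_keyE // /icol /irow; do 2!case: ifP; lia.
Qed.

Lemma greedy_boundary v s x : v = restricted_perm C -> (s < m + n)%N ->
  (x \in greedy boundary_vec (cyc_key s)) =
    let y := ((perm (@rev_ord_inj (m + n)%N) * v * omega)^-1)%g x in
    if (x < m)%N then (s <= x)%N || (y < s)%N else (s <= x)%N && (y < s)%N.
Proof.
move=> vE sd; have inv := final_stage vE; rewrite inE boundary_row_span.
rewrite (eq_row_span (P' := if (s <= x)%N then icol s x else irow s x)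
  (U' := stage_vec m m n)) //;
  last by move=> y; rewrite cyc_key_lt //; case: ifP.
move: inv; set g := (_ * omega)%g => inv.
rewrite /= [((g^-1)%g x < s)%N]ltnNge.
case: (ltnP x m) => xm; case: (leqP s x) => sx /=.
(* A row is not even in the span of all smaller labels: this is [inv_row] for the start [m + n]. *)
- apply/negP => /(@sub_row_span _ _ _ _ _ (irow (m + n) x) _) xs.
  have := inv_row inv xm (ltn_ord x); rewrite [RHS]leqNgt ltn_ord /= => /negP; apply.
  by apply: xs => z; rewrite /icol /irow; lia.
- by rewrite (inv_row inv).
- by rewrite (inv_col inv).
(* A column is in the span of all smaller labels: this is [inv_col] for the start 0. *)
- apply/negbTE; rewrite negbK; have := inv_col inv xm (leq0n x).
  by rewrite leq0n => /sub_row_span; apply=> z; rewrite /icol /irow; lia.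
Qed.

End Weights.

(** * Minors and linkings onto boundary labels *)

Lemma in_minor_rows (I : {set 'I_(m + n)}) i :
  (i \in minor_rows I) = (lshift n i \notin I).
Proof. by rewrite inE. Qed.

Lemma in_minor_cols (I : {set 'I_(m + n)}) j :
  (j \in minor_cols I) = (col_label j \in I).
Proof.
rewrite inE; have jn := ltn_ord j; apply/existsP/idP => [[x /and3P [xI mx /eqP jx]]|jI].
  rewrite (_ : col_label j = x) //; apply: ord_inj => /=.
  by have := ltn_ord x; lia.
by exists (col_label j); rewrite jI /=; apply/andP; split; [|apply/eqP]; lia.
Qed.

Lemma card_minor (I : {set 'I_(m + n)}) : #|I| = m ->
  #|minor_rows I| = #|minor_cols I|.
Proof.
move=> cI; apply/eqP; rewrite -(eqn_add2l #|~: minor_rows I|) addnC cardsC card_ord.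
rewrite -{1}cI -!sum1_card big_mkcond big_split_ord /= -!big_mkcond /=.
apply/eqP; congr (_ + _)%N.
  by apply: eq_bigl => i; rewrite !inE negbK.
rewrite (reindex_inj rev_ord_inj) /=.
by apply: eq_bigl => j; rewrite in_minor_cols.
Qed.

Lemma path_to_source x p i : path (edge C) x p -> last x p = Source n i -> p = [::].
Proof.
case/lastP: p => // p y; rewrite rcons_path last_rcons => /andP [_ +] yi.
by rewrite yi edge_source.
Qed.

Lemma source_notin_path x p i : path (edge C) x p -> Source n i \notin p.
Proof.
elim: p x => //= y p IH x /andP [xy /IH ip]; rewrite inE negb_or ip andbT.
by apply: contraTneq xy => <-; rewrite edge_source.
Qed.

(** Sources in [I] take the trivial path, which avoids the other paths because no edge enters a
    source. Conversely a path ending at a source is trivial, so the paths from [minor_rows I] end at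
    sinks. *)
Lemma disjoint_path_family_linked (I : {set 'I_(m + n)}) (f : 'I_m -> 'I_(m + n)) :
    codom f =i I ->
  disjoint_path_family C (minor_rows I) (minor_cols I) <->
  linked (fun i => Source n i) (edge C) (boundary \o f).
Proof.
move=> fI; have cod x : x \in I -> boundary x \in codom (boundary \o f).
  by rewrite -fI => /codomP [k ->]; apply/codomP; exists k.
split=> [[p [pP dP]]|[p [pP dP]]].
  exists (fun i => if i \in minor_rows I then p i else [::]); split=> [i|i i' nii].
    case: ifP => iI; last first.
      split=> //=; rewrite -boundary_row; apply: cod.
      by move/negbT: iI; rewrite in_minor_rows negbK.
    have [pi [j jT ->]] := pP i iI; split=> //.
    by rewrite -boundary_col; apply: cod; rewrite -in_minor_cols.
  have sub1 k k' : k != k' -> k \in minor_rows I ->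
      [disjoint Source n k :: p k & [:: Source n k']].
    move=> nkk kI; rewrite disjoint_sym disjoint_has /= orbF inE negb_or.
    rewrite (source_notin_path _ (pP k kI).1) andbT.
    by apply: contra nkk => /eqP [->].
  case: ifP => iI; case: ifP => i'I; [exact: dP|exact: sub1|..].
    by rewrite disjoint_sym; apply: sub1; rewrite // eq_sym.
  rewrite disjoint_has /= orbF inE; apply: contra nii => /eqP [->].
  exact: eqxx.
exists p; split=> [i iI|i i' _ _]; last exact: dP.
have [pi /codomP [k lk]] := pP i; split=> //.
have fkI : f k \in I by rewrite -fI codom_f.
move: lk => /=; case: (labelP (f k)) fkI => [[k' ->]|[j ->]] fI'.
  rewrite boundary_row => lk; have p0 := path_to_source pi lk.
  move: lk; rewrite p0 /= => -[ik]; move: iI.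
  by rewrite in_minor_rows ik fI'.
by rewrite boundary_col => ->; exists j; rewrite // in_minor_cols.
Qed.
End CauchonGraph.

(** * Nonvanishing sets as bases of the boundary vectors *)

Section CauchonRepresentation.
Variables (m n : nat) (C : {set 'I_m * 'I_n}).
Local Notation V := (vertex m n).

Lemma cauchon_representation : exists (u : V -> 'rV[rat]_m) (t : V -> V -> rat),
  [/\ forall x y, t x y != 0,
      forall w, u w = \sum_(k | Source n k == w) delta_mx 0 k
                      + \sum_(p | edge C p w) t p w *: u p
    & forall f, det_of u f != 0 <-> linked (fun i => Source n i) (edge C) f].
Proof.
pose le_height (x y : V * V) := (height x.2 <= height y.2)%N.
pose es := sort le_height (enum [pred e : V * V | edge C e.1 e.2]).
have esE x y : ((x, y) \in es) = edge C x y by rewrite mem_sort mem_enum.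
have [||||u [t [t0 uE uP]]] :=
  @gammoid_representation _ _ (fun i : 'I_m => Source n i) (@height m n) es.
- by move=> i i' [].
- by rewrite sort_uniq enum_uniq.
- by move=> x y; rewrite esE; apply: edge_height.
- by apply: sort_sorted => x y; apply: leq_total.
exists u, t; split=> // [w|f].
  by rewrite uE; congr (_ + _); apply: eq_bigl => p; rewrite esE.
by rewrite uP; split; apply: eq_linked => // x y; rewrite /edge_of esE.
Qed.

Variable u : V -> 'rV[rat]_m.
Hypothesis uP : forall f, det_of u f != 0 <-> linked (fun i => Source n i) (edge C) f.

Lemma spanning_det (I : {set 'I_(m + n)}) (f : 'I_m -> 'I_(m + n)) : codom f =i I ->
  spanning (boundary_vec u) I = (det_of u (@boundary m n \o f) != 0).
Proof.
move=> fI; rewrite -unitfE -unitmxE -row_free_unit /row_free /spanning.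
congr (_ == m); apply: eqmx_rank; apply/andP; split.
  apply/row_span_sub => z; rewrite /= -fI => /codomP [k ->].
  have -> : boundary_vec u (f k) = row k (\matrix_k u ((@boundary m n \o f) k)).
    by rewrite rowK.
  exact: row_sub.
apply/row_subP => k; rewrite rowK.
by apply: (@mem_row_span _ _ _ (boundary_vec u)); rewrite /= -fI codom_f.
Qed.

Lemma disjoint_path_family_spanning (I : {set 'I_(m + n)}) : #|I| = m ->
  disjoint_path_family C (minor_rows I) (minor_cols I) <-> spanning (boundary_vec u) I.
Proof.
move=> cI; pose f k := enum_val (cast_ord (esym cI) k).
have fI : codom f =i I.
  move=> x; apply/codomP/idP => [[k ->]|xI]; first exact: enum_valP.
  exists (cast_ord cI (enum_rank_in xI x)).
  by rewrite /f cast_ordK enum_rankK_in.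
by rewrite (spanning_det fI) uP; apply: disjoint_path_family_linked.
Qed.

End CauchonRepresentation.

Theorem theorem1p3 (m n : nat) (F : fieldType) (q : F)
  (m_ge2 : (2 <= m)%N) (n_ge2 : (2 <= n)%N)
  (F_infinite : ~ cardinality.finite_set (@classical_sets.setT F))
  (q_neq0 : q != 0)
  (q_generic : forall k : nat, (0 < k)%N -> q ^+ k <> 1)
  (K : qmat m n q -> Prop) (K_Hprime : Hprime K)
  (C : {set 'I_m * 'I_n}) (K_diagram : cauchon_diagram_of K C)
  (v : 'S_(m + n)) (v_def : v = restricted_perm C)
  (omega : 'S_(m + n))
  (omega_def : forall x : 'I_(m + n),
     (omega x).+1 = if (x.+1 <= m)%N then (m + 1 - x.+1)%N
                    else (2 * m + n + 1 - x.+1)%N) :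
  (forall k : nat, (1 <= k <= n)%N ->
     grassmann_necklace K (m + n - k + 1) =
       (label_itv (m + n) 1 m :|: label_itv (m + n) (m + n - k + 1) (m + n))
         :\: [set omega (v x) | x in label_itv (m + n) 1 k]) /\
  (forall k : nat, (n + 1 <= k <= m + n)%N ->
     grassmann_necklace K (m + n - k + 1) =
       (label_itv (m + n) 1 (m + n)
          :\: [set omega (v x) | x in label_itv (m + n) 1 k])
         :|: label_itv (m + n) (m + n - k + 1) m).
Proof.
have [C_cauchon KC] := K_diagram.
have omegaE (x : 'I_(m + n)) :
    omega x = (if (x < m)%N then m - x.+1 else 2 * m + n - x.+1)%N :> nat.
  by have := omega_def x; have := ltn_ord x; case: ifP; lia.
have [u [t [t0 uE uP]]] := cauchon_representation C.
pose W := boundary_vec u.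
have nonvanishingE I : nonvanishing K I <-> #|I| = m /\ spanning W I.
  rewrite /nonvanishing; split=> -[cI].
    rewrite KC ?card_minor // => /contrapT.
    by move/(disjoint_path_family_spanning uP cI).
  move=> /(disjoint_path_family_spanning uP cI) dI; split=> //.
  by rewrite KC ?card_minor.
(* The set of all row labels gives the empty minor, for which no path is required; so a basis
   exists. *)
have [J0 [cJ0 sJ0]] : exists J : {set 'I_(m + n)}, #|J| = m /\ spanning W J.
  pose J := [set lshift n k | k in 'I_m].
  have cJ : #|J| = m by rewrite card_imset ?card_ord //; apply: lshift_inj.
  exists J; split=> //; apply/(disjoint_path_family_spanning uP cJ).
  have iJ i : i \notin minor_rows J by rewrite in_minor_rows negbK imset_f.
  by exists (fun=> [::]); split=> [i|i i'] iI; case/negP: (iJ i).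
(* The greedy basis has the most elements in every initial segment, so it is a minimum; antisymmetry
   on sorted lists shows that [pick] can return nothing else. *)
have necklaceE s : (s < m + n)%N -> grassmann_necklace K s.+1 = greedy W (cyc_key s).
  move=> sd; have key_inj := cyc_key_inj sd.
  set G := greedy W (cyc_key s).
  have subset_leE (I J : {set 'I_(m + n)}) : subset_le s.+1 I J = all2 (key_le (cyc_key s))
      (sort (key_le (cyc_key s)) (enum I)) (sort (key_le (cyc_key s)) (enum J)).
    by rewrite /subset_le (_ : @cyc_le (m + n)%N s.+1 = key_le (cyc_key s)).
  have [cG sG] := greedy_spanning key_inj cJ0 sJ0.
  have Gmin : is_minimum K s.+1 G.
    split; first exact/nonvanishingE.
    move=> J /nonvanishingE [cJ sJ]; rewrite subset_leE.
    apply: dominance_all2; first by rewrite cG.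
    by move=> p; apply: spanning_below.
  rewrite /grassmann_necklace; case: pickP => [I /asboolP [nI Imin]|/(_ G)].
    have := Imin _ Gmin.1; have := Gmin.2 _ nI; rewrite !subset_leE => GI IG.
    have IGsort := all2_key_anti key_inj IG GI.
    apply/setP => x; rewrite -[LHS]mem_enum -[RHS]mem_enum.
    by rewrite -(mem_sort (key_le (cyc_key s)) (enum I)) IGsort mem_sort.
  by rewrite (asboolT Gmin).
(* As [v] is applied after the reversal, the first [k] labels correspond to the [k] largest values
   of [g^-1]. *)
have imageE k (x : 'I_(m + n)) : (1 <= k <= m + n)%N ->
    (x \in [set omega (v y) | y in label_itv (m + n) 1 k]) =
    (m + n - k <= ((perm (@rev_ord_inj (m + n)%N) * v * omega)^-1)%g x)%N.
  move=> kd; set g := (_ * omega)%g; set z := (g^-1)%g x.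
  have xE : x = omega (v (rev_ord z)) by rewrite -[LHS](permKV g) !permM permE.
  rewrite {1}xE (mem_imset _ _ (inj_comp perm_inj perm_inj)) inE /=.
  by have := ltn_ord z; lia.
(* The start is [s = m + n - k]. If [k <= n], then [s >= m] and no row satisfies [s <= x]; if
   [k > n], then every column does. This turns the criterion of [greedy_boundary] into the two set
   formulas. *)
split=> k kd; rewrite addn1 necklaceE ?(addn1, subn_gt0); try lia.
all: apply/setP => x; rewrite (greedy_boundary t0 uE C_cauchon omegaE _ v_def) /=; last by lia.
all: rewrite !(in_setD, in_setU) imageE; last by lia.
all: rewrite !inE; have := ltn_ord x; case: ifP; lia.
Qed.
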